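(* Let $N,M\ge 1$ be integers. Fix $q,x_i,y_j,z_k\in\mathbb{C}$ such that for some constant $\epsilon<1$, independent of $i,j,k$, one has for all $1\le i\le N$, $1\le j\le M$, $k\ge 1$: $$\left|\frac{(1-q^3y_jz_k)}{(1-qy_jz_k)}\cdot\frac{(x_i-z_k)}{(x_i-q^2z_k)}\right|<\epsilon<1,\qquad \left|\frac{(1-q^2y_jz_k)(1-q^3y_jz_k)}{(1-y_jz_k)(1-qy_jz_k)}\cdot\frac{(x_i-z_k)(x_i-qz_k)}{(x_i-q^2z_k)(x_i-q^3z_k)}\right|<\epsilon<1 .$$ Then $$\sum_{S}c_S(q)\,F_S(x_1,\dots,x_N;\bm{z})\,G_S(y_1,\dots,y_M;q^{-3}\bm{z}^{-1})=q^{N(2N+1)}F_{(2^N)}(x_1,\dots,x_N;\bm{z})\prod_{i=1}^{N}\prod_{j=1}^{M}\frac{(1-q^2x_iy_j)(1-q^3x_iy_j)}{(1-x_iy_j)(1-qx_iy_j)},$$ where the sum is over all 2-strings $S$ with $|S|=2N$, and $q^{-3}\bm{z}^{-1}=(q^{-3}z_1^{-1},q^{-3}z_2^{-1},\dots)$.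
   Context: **Weights.** For $i,j,k,\ell\in\{0,1,2\}$ the Izergin--Korepin vertex weight $W_{y/x}(i,j;k,\ell)$ ($i$ = bottom incoming state, $j$ = left incoming state, $k$ = top outgoing state, $\ell$ = right outgoing state; $x$ = parameter of the horizontal line, $y$ = parameter of the vertical line) is a rational function depending on $x,y$ only through $y/x$; with $D=(x-q^2y)(x-q^3y)$, $W(0,0;0,0)=W(2,2;2,2)=1$; $W(1,0;1,0)=W(2,1;2,1)=\frac{q^2(x-y)}{x-q^2y}$; $W(1,0;0,1)=W(2,1;1,2)=\frac{(1-q^2)x}{x-q^2y}$; $W(0,1;1,0)=W(1,2;2,1)=\frac{(1-q^2)y}{x-q^2y}$; $W(0,1;0,1)=W(1,2;1,2)=\frac{x-y}{x-q^2y}$; $W(2,0;2,0)=\frac{q^4(x-y)(x-qy)}{D}$; $W(2,0;1,1)=-\frac{q(1-q)^2(1+q)x(x-y)}{D}$; $W(2,0;0,2)=\frac{(1-q^2)x(x+qx-qy-q^3y)}{D}$; $W(1,1;2,0)=-\frac{q^4(1+q)(x-y)y}{D}$; $W(1,1;1,1)=\frac{-qx^2+(1+q)(1-q^2+q^4)xy-q^4y^2}{D}$; $W(1,1;0,2)=\frac{(1+q)x(x-y)}{D}$; $W(0,2;2,0)=\frac{(1-q^2)(x+q^2x-q^2y-q^3y)y}{D}$; $W(0,2;1,1)=\frac{q(1-q)^2(1+q)(x-y)y}{D}$; $W(0,2;0,2)=\frac{(x-y)(x-qy)}{D}$; and $W=0$ in all other cases. Parameters are taken away from the poles of the rational functions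 involved. **2-strings.** A 2-string is an infinite vector $S=(S_1,S_2,\dots)$ with $S_i\in\{0,1,2\}$ and only finitely many nonzero entries; $|S|=\sum_i S_i$. Trailing zeros may be dropped; $(2^N)=(2,\dots,2,0,0,\dots)$ with $N$ twos. $\bm{z}=(z_1,z_2,\dots)$. **$F_S$.** Let $|S|=2N$ and choose $L$ with $S_c=0$ for $c>L$. Then $$F_S(x_1,\dots,x_N;\bm{z})=\sum\prod_{r=1}^{N}\prod_{c=1}^{L}W_{z_c/x_r}(v_{r-1,c},h_{r,c-1};v_{r,c},h_{r,c}),$$ summed over all $h_{r,c}\in\{0,1,2\}$ ($1\le r\le N$, $0\le c\le L$) and $v_{r,c}\in\{0,1,2\}$ ($0\le r\le N$, $1\le c\le L$) with $h_{r,0}=2$, $h_{r,L}=0$, $v_{0,c}=0$, $v_{N,c}=S_c$. (Independent of $L$.) **$G_S$.** Let $|S|=2N$ and choose $L\ge N$ with $S_c=0$ for $c>L$. Then $$G_S(y_1,\dots,y_M;\bm{z})=\sum\prod_{r=1}^{M}\prod_{c=1}^{L}W_{z_c/y_r}(v_{r-1,c},h_{r,c-1};v_{r,c},h_{r,c}),$$ summed over all $h_{r,c},v_{r,c}\in\{0,1,2\}$ with $h_{r,0}=h_{r,L}=0$, $v_{0,c}=2$ for $c\le N$, $v_{0,c}=0$ for $c>N$, and $v_{M,c}=S_c$. (Independent of $L$.) **The constant $c_S(q)$.** With $\mathfrak{c}_i(S)=\#\{j:S_j=i\}$ for $i=1,2$, $$c_S(q)=(-1)^{\mathfrak{c}_1(S)/2}(1-q)^{-\mathfrak{c}_1(S)}q^{-\mathfrak{c}_2(S)}\prod_{k\ge1}q^{2kS_k}.$$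 (When $|S|=2N$, $\mathfrak{c}_1(S)$ is even.)
   Formalization: Added, as the claim is false without them: bounds <ε for all k on the mixed products (two y_j first-type ratios with one x_i second-type ratio, and the reverse, for distinct indices), and parameters avoid the poles uniformly in k; the sum is taken as unconditional convergence. *)

(* Defs.v *)
From HB Require Import structures.
From mathcomp Require Import all_boot all_order all_algebra.
From mathcomp Require Import finmap.
From mathcomp Require Import complex.
From mathcomp Require Import boolp classical_sets reals topology normedtype.
From mathcomp.analysis Require Import showcase.summability.

Set Implicit Arguments.
Unset Strict Implicit.
Unset Printing Implicit Defensive.

Import Order.TTheory GRing.Theory Num.Theory.
Import numFieldNormedType.Exports.

(* The Izergin-Korepin weight W_{y/x}(i, j; k, l), with i = bottom, j = left
   (incoming), k = top, l = right (outgoing).  It is homogeneous of degree 0 in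
   (x, y), so it depends on y / x only; x and y are kept as separate arguments. *)
Definition ik_weight (K : fieldType) (q x y : K) (i j k l : nat) : K :=
  (let d := x - q ^+ 2 * y in
   let D := d * (x - q ^+ 3 * y) in
   match i, j, k, l with
   | 0%N, 0%N, 0%N, 0%N | 2%N, 2%N, 2%N, 2%N => 1
   | 1%N, 0%N, 1%N, 0%N | 2%N, 1%N, 2%N, 1%N => q ^+ 2 * (x - y) / d
   | 1%N, 0%N, 0%N, 1%N | 2%N, 1%N, 1%N, 2%N => (1 - q ^+ 2) * x / d
   | 0%N, 1%N, 1%N, 0%N | 1%N, 2%N, 2%N, 1%N => (1 - q ^+ 2) * y / d
   | 0%N, 1%N, 0%N, 1%N | 1%N, 2%N, 1%N, 2%N => (x - y) / d
   | 2%N, 0%N, 2%N, 0%N => q ^+ 4 * (x - y) * (x - q * y) / D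
   | 2%N, 0%N, 1%N, 1%N =>
       - (q * (1 - q) ^+ 2 * (1 + q) * x * (x - y) / D)
   | 2%N, 0%N, 0%N, 2%N =>
       (1 - q ^+ 2) * x * (x + q * x - q * y - q ^+ 3 * y) / D
   | 1%N, 1%N, 2%N, 0%N => - (q ^+ 4 * (1 + q) * (x - y) * y / D)
   | 1%N, 1%N, 1%N, 1%N =>
       (- (q * x ^+ 2) + (1 + q) * (1 - q ^+ 2 + q ^+ 4) * x * y
        - q ^+ 4 * y ^+ 2) / D
   | 1%N, 1%N, 0%N, 2%N => (1 + q) * x * (x - y) / D
   | 0%N, 2%N, 2%N, 0%N =>
       (1 - q ^+ 2) * (x + q ^+ 2 * x - q ^+ 2 * y - q ^+ 3 * y) * y / D
   | 0%N, 2%N, 1%N, 1%N => q * (1 - q) ^+ 2 * (1 + q) * (x - y) * y / D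
   | 0%N, 2%N, 0%N, 2%N => (x - y) * (x - q * y) / D
   | _, _, _, _ => 0
   end)%R.

Local Open Scope ring_scope.

(* Edge states; inord n has value n for n = 0, 1, 2. *)
Notation state := 'I_3.
Definition st0 : state := inord 0.
Definition st2 : state := inord 2.

(* 2-strings (S_1, S_2, ...).  Positions are numbered from 0: S k, like z k
   below, stands for the entry with index k.+1. *)
Definition string2 : choiceType := {fsfun nat -> state with ord0}.

Definition size2 (S : string2) : nat := (\sum_(k <- finsupp S) S k)%N.

Definition supp_bound (S : string2) : nat := (\max_(k <- finsupp S) k.+1)%N.

Definition mult2 (i : nat) (S : string2) : nat :=
  count (fun k => S k == i :> nat) (finsupp S).

Definition twos (N : nat) : string2 :=
  [fsfun k in [fset k | k in iota 0 N]%fset => st2 | ord0].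

Definition strings_of_size (n : nat) : choiceType :=
  {S : string2 | size2 S == n}.

(* Partition function of an m x L lattice: row r (from the bottom) carries the
   parameter u r and column c (from the left) the parameter z c; every left edge
   is in state a, every right edge in state b, and the bottom and top edges of
   column c are in states bot c and top c.  The entry h r c (resp. v r c) is the
   state of the horizontal (resp. vertical) edge on the left of (resp. below)
   the vertex in row r and column c. *)
Definition lattice_sum (K : fieldType) (q : K) (m L : nat) (u : 'I_m -> K)
    (z : nat -> K) (a b : state) (bot top : nat -> state) : K :=
  \sum_(h : 'M[state]_(m, L.+1)
        | [forall r, (h r ord0 == a) && (h r ord_max == b)])
  \sum_(v : 'M[state]_(m.+1, L)
        | [forall c, (v ord0 c == bot c) && (v ord_max c == top c)])
    \prod_(r < m) \prod_(c < L)
      ik_weight q (u r) (z c)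
        (v (widen_ord (leqnSn m) r) c) (h r (widen_ord (leqnSn L) c))
        (v (lift ord0 r) c) (h r (lift ord0 c)).

(* F_S and G_S do not depend on the number L of columns, as long as L is at
   least supp_bound S (and at least N for G_S); the smallest such L is used. *)
Definition F (K : fieldType) (q : K) (N : nat) (x : 'I_N -> K) (z : nat -> K)
    (S : string2) : K :=
  lattice_sum q (supp_bound S) x z st2 st0 (fun=> st0) S.

Definition G (K : fieldType) (q : K) (N M : nat) (y : 'I_M -> K) (z : nat -> K)
    (S : string2) : K :=
  lattice_sum q (maxn N (supp_bound S)) y z st0 st0
    (fun c => if (c < N)%N then st2 else st0) S.

(* The power (-1)^(c_1(S)/2) is only meaningful when c_1(S) is even, which is
   the case when size2 S is. *)
Definition cS (K : fieldType) (q : K) (S : string2) : K :=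
  (-1) ^+ (mult2 1 S)./2 * (1 - q) ^- mult2 1 S * q ^- mult2 2 S
  * \prod_(k <- finsupp S) q ^+ (2 * k.+1 * S k)%N.

(* Unconditional summation: the net of finite partial sums converges to s
   (for complex-valued families this amounts to absolute convergence). *)
Definition has_sum (R : realType) (I : choiceType) (f : I -> R[i]) (s : R[i]) :
    Prop :=
  (partial_sum f @ totally --> (s : (R[i] : numFieldType)))%classic.

(* The parameters stay away from the poles of all rational functions involved,
   uniformly in k for the weights W_{z_k/x_i} and W_{q^-3 z_k^-1/y_j} (whose
   denominators are the four linear forms below, measured against the size of
   their terms): the sequence z is infinite, and avoiding the poles for each k
   separately would let z k tend to a pole and make the sum over S diverge. *)
Definition away_from_poles (R : realType) (N M : nat) (q : R[i])
    (x : 'I_N -> R[i]) (y : 'I_M -> R[i]) (z : nat -> R[i]) : Prop :=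
  [/\ q != 0, q != 1, (forall k, z k != 0),
      (forall i j, (1 - x i * y j != 0) && (1 - q * x i * y j != 0)) &
      exists2 delta : R, 0 < delta &
        (forall i k,
            delta%:C * (`|x i| + `|z k|) <= `|x i - q ^+ 2 * z k| /\
            delta%:C * (`|x i| + `|z k|) <= `|x i - q ^+ 3 * z k|)%C /\
        (forall j k,
            delta%:C * (1 + `|y j * z k|) <= `|1 - y j * z k| /\
            delta%:C * (1 + `|y j * z k|) <= `|1 - q * y j * z k|)%C].

(* In one column, a row x_i whose horizontal edge carries 2 can face two rows
   y_j, y_j' carrying 1 each (and symmetrically).  The sum over S contains the
   corresponding geometric contributions, which the bounds pairing one x_i with
   one y_j do not control: for N = 1, M = 2, q = 1/4, x_1 = 5/4, y_1 = y_2 = 3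
   and z_k = 1, both such bounds hold but the ratio below is about 2.48 and
   the sum over S diverges.  Both conditions are vacuous when N = M = 1. *)
Definition mixed_ratio_bounds (R : realType) (N M : nat) (eps : R) (q : R[i])
    (x : 'I_N -> R[i]) (y : 'I_M -> R[i]) (z : nat -> R[i]) : Prop :=
  (forall i j j' k, j != j' ->
     `| (1 - q ^+ 3 * y j * z k) / (1 - q * y j * z k)
        * ((1 - q ^+ 3 * y j' * z k) / (1 - q * y j' * z k))
        * (((x i - z k) * (x i - q * z k))
          / ((x i - q ^+ 2 * z k) * (x i - q ^+ 3 * z k))) | < eps%:C)%C /\
  (forall i i' j k, i != i' ->
     `| ((1 - q ^+ 2 * y j * z k) * (1 - q ^+ 3 * y j * z k))
          / ((1 - y j * z k) * (1 - q * y j * z k))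
        * ((x i - z k) / (x i - q ^+ 2 * z k))
        * ((x i' - z k) / (x i' - q ^+ 2 * z k)) | < eps%:C)%C.

(* Main.v *)
Require Import Defs.
From mathcomp Require Import all_boot all_order all_algebra.
From mathcomp Require Import finmap complex reals.
From mathcomp Require Import boolp classical_sets topology normedtype sequences.
From mathcomp.analysis Require Import showcase.summability.
From mathcomp Require Import zify ring lra.
Set Implicit Arguments.
Unset Strict Implicit.
Unset Printing Implicit Defensive.
Import Order.TTheory GRing.Theory Num.Theory.
Import numFieldNormedType.Exports.
Local Open Scope ring_scope.
Local Open Scope complex_scope.

(** The Cauchy identity is a train argument in a lattice with two kinds of
rows, followed by a limit in the number L of columns.

_Gluing._  Turn the lattice of G_S upside down and replace each horizontal
state j by 2 - j.  By the crossing symmetry of the Izergin-Korepin weights the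
result is, up to a gauge factor which is exactly c_S(q) q^(-N(2N+1)), a lattice
whose row of parameter y carries the weights of a horizontal line of parameter
1/y, normalised so that W(0,2;0,2) = 1 ([cS_G]).  Summing over the 2-strings
supported in the first L columns therefore glues the lattice of F to this one
([sum_glued]): the partial sum is q^(N(2N+1)) times the partition function
[cauchy_grid] of a lattice with N rows x_i below M rows y_j, all left edges in
state 2, bottom 0, top (2^N), and right edges in the ground state: 0 on the
rows x_i and 2 on the rows y_j.

_Exchange._  By the Yang-Baxter equation ([ik_num_yang_baxter], a finite list
of polynomial identities), the lowest row y can be moved below all rows x_i at
the price of a crossing operator acting on the right edges ([cross_grid]); on
the left the crossing is frozen by the states 2.  At the bottom of the lattice
the row y is frozen in state 2 and disappears ([grid_frozen]).  The coefficient
of the ground state gives the factor of the product formula, and the other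
terms are partition functions with a right boundary different from the ground
state ([exchange_step]).

_Limit._  Past the N-th column, where bottom and top are 0, a state can only
move upwards through the rows, so that the column-to-column kernels are
triangular for the order given by [potential], and the ground state, which
minimises it among the states with the same sum, is absorbing.  The diagonal
entry at any other such state splits into products of the four kinds that the
hypotheses bound by eps ([pairing], [contracting_diag]).  Hence the partition
functions with another right boundary decay geometrically, even after all
weights are replaced by their absolute values ([decay]).  This kills the error
terms, so that the row y contributes its factor in the limit, and an induction
on the rows y gives the limit of the partial sums ([cauchy_grid_limit]).  For
the ground state the same estimate bounds the sums of the norms, which makes
the summation unconditional ([has_sum_exhaust]). *)

(** * Partition functions of rectangular lattices, column by column *)

(** A vertex weight, as a function of the states bottom, left, top, right. The
states are natural numbers, of which only 0, 1, 2 matter. *)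
Definition vweight (K : Type) := nat -> nat -> nat -> nat -> K.

Section Lattice.
Variable K : comNzRingType.
Implicit Types (w : vweight K) (ws : seq (vweight K)) (s t : seq state).

(** Partition function of one column: [ws] lists the weights of its rows from
bottom to top, [s] and [t] the states of the left and right edges, [b] and [p]
are the states of the bottom and top edges. It is 0 if the lengths disagree. *)
Fixpoint column ws s t (b p : state) : K :=
  match ws, s, t with
  | w :: ws', a :: s', a' :: t' =>
      \sum_(v : state) w b a v a' * column ws' s' t' v p
  | [::], [::], [::] => (b == p)%:R
  | _, _, _ => 0
  end.

(** Partition function of a lattice with [m] rows: the columns are labelled from
left to right by the list [ks], column [k] has weights [ws k] and boundary
states [bot k], [top k], and [s], [t] are the outer left and right edges. *)
Fixpoint grid (m : nat) (ws : nat -> seq (vweight K)) (bot top : nat -> state)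
    (ks : seq nat) s t : K :=
  match ks with
  | [::] => (s == t)%:R
  | k :: ks' => \sum_(u : m.-tuple state)
                  column (ws k) s u (bot k) (top k) * grid m ws bot top ks' u t
  end.

Lemma row_mx_ord0 (T : Type) m n (A : 'M[T]_(m, 1)) (B : 'M[T]_(m, n)) i :
  @row_mx T m 1 n A B i (ord0 : 'I_n.+1) = A i ord0.
Proof. by rewrite -(row_mxEl A B); congr fun_of_matrix; apply/val_inj. Qed.

Lemma row_mx_lift (T : Type) m n (A : 'M[T]_(m, 1)) (B : 'M[T]_(m, n)) i j :
  @row_mx T m 1 n A B i (lift ord0 j : 'I_n.+1) = B i j.
Proof. by rewrite -(row_mxEr A B); congr fun_of_matrix; apply/val_inj. Qed.

Lemma sum_column m (w : 'I_m -> vweight K) (a a' : m.-tuple state) (b p : state) :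
  \sum_(v : 'M[state]_(1, m.+1) | (v ord0 ord0 == b) && (v ord0 ord_max == p))
    \prod_(r < m) w r (v ord0 (widen_ord (leqnSn m) r)) (tnth a r)
                      (v ord0 (lift ord0 r)) (tnth a' r)
  = column [seq w r | r <- enum 'I_m] a a' b p.
Proof.
elim: m => [|m IH] in w a a' b p *.
  rewrite (tuple0 a) (tuple0 a') (_ : enum _ = [::]) /=; last first.
    by apply/size0nil; rewrite size_enum_ord.
  have [<-|bp] := eqVneq b p.
    rewrite (big_pred1 (const_mx b)) ?big_ord0 // => v.
    rewrite (_ : ord_max = ord0) ?andbb; last exact/val_inj.
    apply/eqP/eqP => [vb|->]; last by rewrite mxE.
    by apply/matrixP => i j; rewrite !ord1 mxE vb.
  rewrite big1 // => v; rewrite (_ : ord_max = ord0) //; last exact/val_inj.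
  by case: eqP => [->|//]; rewrite (negPf bp).
case/tupleP: a => x a; case/tupleP: a' => x' a'.
rewrite enum_ordSl /= -map_comp.
pose f (v : 'M[state]_(1, m.+1)) : 'M[state]_(1, m.+2) :=
  @row_mx _ 1 1 m.+1 (const_mx b) v.
rewrite (reindex_onto f (fun v => \matrix_(i, j) v i (lift ord0 j))); last first.
  move=> v /andP[/eqP vb _]; apply/matrixP => i j; rewrite ord1 {i}.
  by case: (unliftP ord0 j) => [j' ->|->];
    rewrite /f ?row_mx_lift ?row_mx_ord0 mxE.
rewrite (eq_bigl (fun v : 'M_(1, m.+1) => v ord0 ord_max == p)); last first.
  move=> v; rewrite /f row_mx_ord0 mxE eqxx /=.
  rewrite (_ : ord_max = lift ord0 (ord_max : 'I_m.+1)); last exact/val_inj.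
  rewrite row_mx_lift; set e := (X in _ && X); suff -> : e by rewrite andbT.
  by apply/eqP/matrixP => i j; rewrite mxE row_mx_lift.
rewrite (partition_big (fun v : 'M_(1, m.+1) => v ord0 ord0) predT) //=.
apply: eq_bigr => y _; rewrite -IH big_distrr /=.
apply: eq_big => [v|v /andP[_ /eqP vy]]; first by rewrite andbC.
rewrite big_ord_recl !tnth0; congr (_ * _).
  rewrite /f row_mx_lift vy.
  rewrite (_ : widen_ord _ _ = ord0); last exact/val_inj.
  by rewrite row_mx_ord0 mxE.
apply: eq_bigr => r _; rewrite !tnthS /f !row_mx_lift.
rewrite (_ : widen_ord _ _ = lift ord0 (widen_ord (leqnSn m) r)); last exact/val_inj.
by rewrite row_mx_lift.
Qed.

(** The sum over all edge configurations, evaluated one column at a time. The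
columns are numbered from [k0], which is what the induction needs. *)
Lemma lattice_grid m L (w : 'I_m -> nat -> vweight K) (a b : m.-tuple state)
    (bot top : nat -> state) k0 :
  \sum_(h : 'M[state]_(m, L.+1)
        | [forall r, (h r ord0 == tnth a r) && (h r ord_max == tnth b r)])
  \sum_(v : 'M[state]_(m.+1, L)
        | [forall c, (v ord0 c == bot (k0 + c)%N) && (v ord_max c == top (k0 + c)%N)])
    \prod_(r < m) \prod_(c < L)
      w r (k0 + c)%N
        (v (widen_ord (leqnSn m) r) c) (h r (widen_ord (leqnSn L) c))
        (v (lift ord0 r) c) (h r (lift ord0 c))
  = grid m (fun k => [seq w r k | r <- enum 'I_m]) bot top (iota k0 L) a b.
Proof.
elim: L => [|L IH] in k0 a *.
  have E (h : 'M[state]_(m, 1)) :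
     \sum_(v : 'M[state]_(m.+1, 0)
        | [forall c, (v ord0 c == bot (k0 + c)%N) && (v ord_max c == top (k0 + c)%N)])
     \prod_(r < m) \prod_(c < 0)
      w r (k0 + c)%N
        (v (widen_ord (leqnSn m) r) c) (h r (widen_ord (leqnSn 0) c))
        (v (lift ord0 r) c) (h r (lift ord0 c)) = 1.
    rewrite (big_pred1 (\matrix_(i, j) ord0)) => [|v].
      by rewrite big1 // => r _; rewrite big_ord0.
    rewrite /=; transitivity true; first by apply/forallP => -[].
    by apply/esym/eqP/matrixP => i [].
  rewrite (eq_bigr (fun=> 1)) => [|h _]; last exact: E.
  have O : (ord_max : 'I_1) = ord0 by apply/val_inj.
  rewrite /= O.
  have [ab|ab] := eqVneq (a : seq _) b; last first.
    rewrite big_pred0 // => h; apply/negP => /forallP H; case/eqP: ab.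
    congr val; apply/eq_from_tnth => r.
    by have /andP[/eqP <- /eqP <-] := H r.
  rewrite (big_pred1 (\matrix_(i, j) tnth a i)) // => h.
  apply/forallP/eqP => [H|-> r].
    by apply/matrixP => i j; rewrite mxE ord1; have /andP[/eqP ->] := H i.
  by rewrite !mxE eqxx; apply/eqP; congr tnth; apply/val_inj.
(* The first column of h is the left boundary a, and its second column is the
boundary u between the first column of vertices and the others. *)
pose fh (h : 'M[state]_(m, L.+1)) : 'M[state]_(m, L.+2) :=
  @row_mx _ m 1 L.+1 (\matrix_(i, j) tnth a i) h.
rewrite (reindex_onto fh (fun h => \matrix_(i, j) h i (lift ord0 j))); last first.
  move=> h /forallP H; apply/matrixP => i j.
  case: (unliftP ord0 j) => [j' ->|->]; rewrite /fh ?row_mx_lift ?row_mx_ord0 mxE //.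
  by have /andP[/eqP ->] := H i.
rewrite (eq_bigl (fun h : 'M_(m, L.+1) =>
    [forall r, h r ord_max == tnth b r])); last first.
  move=> h; rewrite -[RHS]andbT; congr (_ && _); last first.
    by apply/eqP/matrixP => i j; rewrite mxE row_mx_lift.
  apply: eq_forallb => r; rewrite row_mx_ord0 mxE eqxx /=.
  rewrite (_ : ord_max = lift ord0 (ord_max : 'I_L.+1)); last exact/val_inj.
  by rewrite row_mx_lift.
pose tu (h : 'M[state]_(m, L.+1)) := [tuple h r ord0 | r < m].
rewrite (partition_big tu predT) //=.
apply: eq_bigr => u _; rewrite -IH -sum_column.
rewrite big_distrr /=; apply: eq_big => [h|h /andP[/forallP Hb /eqP hu]].
  apply/andP/forallP => [[/forallP Hb /eqP <-] r|H].
    by rewrite tnth_mktuple eqxx (eqP (Hb r)) eqxx.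
  split; first by apply/forallP => r; have /andP[] := H r.
  by apply/eqP/eq_from_tnth => r; rewrite tnth_mktuple; have /andP[/eqP ->] := H r.
have hu0 r : h r ord0 = tnth u r by rewrite -hu tnth_mktuple.
rewrite big_distrlr /= pair_big /=.
pose fv (p : 'M[state]_(1, m.+1) * 'M[state]_(m.+1, L)) : 'M[state]_(m.+1, L.+1) :=
  @row_mx _ m.+1 1 L p.1^T p.2.
rewrite (reindex_onto fv (fun v => (\matrix_(i, j) v j ord0,
  \matrix_(i, j) v i (lift ord0 j)))); last first.
  move=> v _; apply/matrixP => i j.
  by case: (unliftP ord0 j) => [j' ->|->]; rewrite /fv ?row_mx_lift ?row_mx_ord0 !mxE.
apply: eq_big => [[v1 v2]|[v1 v2] _] /=.
  rewrite -[RHS]andbT; congr (_ && _); last first.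
    apply/eqP; congr pair; apply/matrixP => i j.
      by rewrite ord1 mxE row_mx_ord0 mxE.
    by rewrite mxE row_mx_lift.
  apply/forallP/andP => [H|[/andP[v1b v1p] /forallP H] c].
    split; first by have := H ord0; rewrite /fv !row_mx_ord0 !mxE addn0.
    by apply/forallP => c; have := H (lift ord0 c); rewrite /fv !row_mx_lift addnS.
  case: (unliftP ord0 c) => [c' ->|->]; rewrite /fv ?row_mx_lift ?row_mx_ord0.
    by rewrite /= /bump /= addnA addn1; exact: H.
  by rewrite !mxE addn0 v1b v1p.
rewrite -big_split /=; apply: eq_bigr => r _.
rewrite big_ord_recl /fv /fh /= addn0.
rewrite (_ : widen_ord _ ord0 = ord0); last exact/val_inj.
rewrite !row_mx_ord0 !row_mx_lift !mxE hu0; congr (_ * _).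
apply: eq_bigr => c _; rewrite !row_mx_lift.
rewrite (_ : widen_ord _ (lift _ _) = lift ord0 (widen_ord (leqnSn L) c)); last exact/val_inj.
by rewrite row_mx_lift /= /bump /= addnA addn1.
Qed.
End Lattice.

(** * Composition of columns and of stacks of rows *)

Lemma big_tuple_cons (V : nmodType) (T : finType) m (F : seq T -> V) :
  \sum_(u : m.+1.-tuple T) F u = \sum_(a : T) \sum_(u : m.-tuple T) F (a :: u).
Proof.
rewrite pair_big /=.
rewrite (reindex (fun p : T * m.-tuple T => [tuple of p.1 :: p.2])) //=.
exists (fun u : m.+1.-tuple T => (thead u, [tuple of behead u])).
  by move=> [a u] _; rewrite theadE; congr pair; apply/val_inj.
by move=> u _; rewrite [RHS](tuple_eta u).
Qed.

Lemma big_tuple_nil (V : nmodType) (T : finType) (F : seq T -> V) :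
  \sum_(u : 0.-tuple T) F u = F [::].
Proof.
rewrite (big_pred1 [tuple]) // => u.
by apply/esym/eqP; exact: tuple0.
Qed.

Lemma big_tuple_cat (V : nmodType) (T : finType) m n (F : seq T -> V) :
  \sum_(u : (m + n).-tuple T) F u
  = \sum_(u : m.-tuple T) \sum_(v : n.-tuple T) F (u ++ v).
Proof.
elim: m F => [|m IH] F.
  by rewrite (big_tuple_nil (fun u => \sum_(v : n.-tuple T) F (u ++ v))).
rewrite big_tuple_cons.
rewrite (big_tuple_cons m (fun u => \sum_(v : n.-tuple T) F (u ++ v))).
by apply: eq_bigr => a _; rewrite (IH (fun u => F (a :: u))).
Qed.

Lemma big_tuple_delta (K : pzSemiRingType) (T : finType) m (s : seq T) (F : seq T -> K) :
  size s = m -> \sum_(u : m.-tuple T) (s == u)%:R * F u = F s.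
Proof.
move=> /eqP sm; rewrite (bigD1 (Tuple sm)) //= eqxx mul1r big1 ?addr0 // => u us.
by case: eqP => [E|]; [case/eqP: us; apply/val_inj | rewrite mul0r].
Qed.

(** The predicate [P] holds for all entries of a list; the entries need not have
a decidable equality. *)
Fixpoint every (T : Type) (P : T -> Prop) (s : seq T) : Prop :=
  if s is x :: s' then P x /\ every P s' else True.

Lemma every_cat (T : Type) (P : T -> Prop) s1 s2 :
  every P (s1 ++ s2) <-> every P s1 /\ every P s2.
Proof. by elim: s1 => [|x s1 IH] /=; [|rewrite IH]; tauto. Qed.

Lemma every_map (T U : Type) (f : T -> U) (P : U -> Prop) s :
  (forall x, P (f x)) -> every P (map f s).
Proof. by move=> H; elim: s. Qed.

Lemma sum_neq0 (V : nmodType) (I : finType) (F : I -> V) :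
  \sum_i F i != 0 -> exists i, F i != 0.
Proof.
move=> nz; apply/existsP; apply/contraNT: nz => /existsPn H.
by apply/eqP/big1 => i _; have := H i; rewrite negbK => /eqP.
Qed.

Lemma mul_neq0 (K : pzSemiRingType) (x y : K) : x * y != 0 -> x != 0 /\ y != 0.
Proof.
by move=> nz; split; apply/contraNneq: nz => ->; rewrite ?mul0r ?mulr0.
Qed.

Section Composition.
Variable K : comNzRingType.
Implicit Types (w : vweight K) (ws : seq (vweight K)) (s t : seq state).

(** The incoming and the outgoing states have the same sum. *)
Definition conserving w := forall i j k l : state, w i j k l != 0 -> (i + j = k + l)%N.

(** The sum of the states of a list of edges. *)
Definition flow s := sumn (map val s).

Lemma column_size ws s t b p :
  column ws s t b p != 0 -> size s = size ws /\ size t = size ws.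
Proof.
elim: ws s t b => [|w ws IH] [|a s] [|a' t] b /=; rewrite ?eqxx //.
by case/sum_neq0 => v /mul_neq0[_ /IH[-> ->]].
Qed.

Lemma column_cat ws1 ws2 s1 s2 t1 t2 b p :
  size s1 = size ws1 -> size t1 = size ws1 ->
  column (ws1 ++ ws2) (s1 ++ s2) (t1 ++ t2) b p
  = \sum_(v : state) column ws1 s1 t1 b v * column ws2 s2 t2 v p.
Proof.
elim: ws1 s1 t1 b => [|w ws1 IH] [|a s1] [|a' t1] b //=.
  move=> _ _; rewrite (bigD1 b) //= eqxx mul1r big1 ?addr0 // => v.
  by rewrite eq_sym => /negPf->; rewrite mul0r.
move=> [Es] [Et].
rewrite (eq_bigr _ (fun v _ => congr1 _ (IH s1 t1 v Es Et))).
under eq_bigr do rewrite big_distrr /=.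
rewrite exchange_big /=; apply: eq_bigr => v _; rewrite big_distrl /=.
by apply: eq_bigr => v' _; rewrite mulrA.
Qed.

Lemma column_conserve ws s t b p :
  every conserving ws ->
  column ws s t b p != 0 -> (b + flow s = p + flow t)%N.
Proof.
elim: ws s t b => [|w ws IH] [|a s] [|a' t] b /=; rewrite ?eqxx //.
  by move=> _; case: (b =P p) => [->|]; rewrite ?eqxx.
case=> Hw Hws /sum_neq0[v /mul_neq0[/Hw E1 /(IH _ _ _ Hws) E2]].
by move: E1 E2; rewrite /flow /=; lia.
Qed.

Lemma grid_conserve m (ws : nat -> seq (vweight K)) bot top ks s t :
  (forall k, every conserving (ws k)) ->
  grid m ws bot top ks s t != 0 ->
  (\sum_(k <- ks) bot k + flow s = \sum_(k <- ks) top k + flow t)%N.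
Proof.
move=> H; elim: ks s => [|k ks IH] s /=.
  by rewrite !big_nil; case: (s =P t) => [->|]; rewrite ?eqxx.
case/sum_neq0 => u /mul_neq0[/(column_conserve (H k)) E1 /IH E2].
by rewrite !big_cons; move: E1 E2; lia.
Qed.

Lemma grid_cat m (ws : nat -> seq (vweight K)) bot top ks1 ks2 s t : size s = m ->
  grid m ws bot top (ks1 ++ ks2) s t
  = \sum_(u : m.-tuple state) grid m ws bot top ks1 s u * grid m ws bot top ks2 u t.
Proof.
elim: ks1 s => [|k ks1 IH] s sm /=.
  by rewrite (big_tuple_delta (grid m ws bot top ks2 ^~ t)).
under eq_bigr => u _ do rewrite IH ?size_tuple // big_distrr /=.
rewrite exchange_big /=; apply: eq_bigr => v _; rewrite big_distrl /=.
by apply: eq_bigr => u _; rewrite mulrA.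
Qed.

Lemma eq_grid m (ws ws' : nat -> seq (vweight K)) bot bot' top top' ks s t :
  {in ks, forall k, [/\ ws k = ws' k, bot k = bot' k & top k = top' k]} ->
  grid m ws bot top ks s t = grid m ws' bot' top' ks s t.
Proof.
elim: ks s => //= k ks IH s H; apply: eq_bigr => u _.
have [-> -> ->] := H k (mem_head _ _); rewrite IH // => k' k's.
by apply: H; rewrite inE k's orbT.
Qed.

(** Summing over the states [S] of the edges between two stacks of rows glues
the stacks together. *)
Lemma grid_stack m1 m2 (ws1 ws2 : nat -> seq (vweight K)) bot top k0 L s1 s2 t1 t2 :
  (forall k, size (ws1 k) = m1) ->
  size s1 = m1 -> size s2 = m2 -> size t1 = m1 -> size t2 = m2 ->
  \sum_(S : L.-tuple state)
     grid m1 ws1 bot (fun k => nth st0 S (k - k0)) (iota k0 L) s1 t1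
   * grid m2 ws2 (fun k => nth st0 S (k - k0)) top (iota k0 L) s2 t2
  = grid (m1 + m2) (fun k => ws1 k ++ ws2 k) bot top (iota k0 L) (s1 ++ s2) (t1 ++ t2).
Proof.
move=> sw; elim: L k0 s1 s2 => [|L IH] k0 s1 s2 E1 E2 F1 F2 /=.
  rewrite (big_tuple_nil (fun=> (s1 == t1)%:R * (s2 == t2)%:R : K)) eqseq_cat ?E1 ?F1 //.
  by rewrite -natrM mulnb.
rewrite (big_tuple_cons _ (fun S =>
  (\sum_(u : m1.-tuple state)
   column (ws1 k0) s1 u (bot k0) (nth st0 S (k0 - k0)) *
   grid m1 ws1 bot (fun k => nth st0 S (k - k0)) (iota k0.+1 L) u t1) *
  (\sum_(u : m2.-tuple state) column (ws2 k0) s2 u (nth st0 S (k0 - k0)) (top k0) *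
   grid m2 ws2 (fun k => nth st0 S (k - k0)) top (iota k0.+1 L) u t2))).
rewrite (big_tuple_cat _ _ (fun u => column _ _ u _ _ * grid (m1 + m2) _ _ _ _ u _)).
under [RHS]eq_bigr => u1 _ do under eq_bigr => u2 _ do
  rewrite column_cat ?sw ?size_tuple // -IH ?size_tuple // big_distrlr /=.
have E (S : L.-tuple state) (a : state) k : k \in iota k0.+1 L ->
    nth st0 (a :: S) (k - k0) = nth st0 S (k - k0.+1).
  by rewrite mem_iota => /andP[lk _]; rewrite -[(k - k0)%N]prednK ?subnS ?subn_gt0.
transitivity (\sum_(a : state) \sum_(S : L.-tuple state)
   \sum_(u1 : m1.-tuple state) \sum_(u2 : m2.-tuple state)
   column (ws1 k0) s1 u1 (bot k0) a * column (ws2 k0) s2 u2 a (top k0) *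
   (grid m1 ws1 bot (fun k => nth st0 S (k - k0.+1)) (iota k0.+1 L) u1 t1
   * grid m2 ws2 (fun k => nth st0 S (k - k0.+1)) top (iota k0.+1 L) u2 t2)).
  apply: eq_bigr => a _; apply: eq_bigr => S _; rewrite big_distrlr /=.
  apply: eq_bigr => u1 _; apply: eq_bigr => u2 _; rewrite subnn /= mulrACA.
  by congr (_ * (_ * _)); apply: eq_grid => k /(E S a) ->.
rewrite exchange_big /=.
under eq_bigr do rewrite exchange_big /=.
rewrite exchange_big /=; apply: eq_bigr => u1 _.
under eq_bigr do rewrite exchange_big /=.
rewrite exchange_big /=; apply: eq_bigr => u2 _.
by rewrite exchange_big.
Qed.

End Composition.

(** * The Yang-Baxter equation *)

(** The Yang-Baxter equation for two horizontal lines and one vertical line: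
[r] is the weight of the crossing of the horizontal lines, and the line with
weights [wy] is below the one with weights [wx] on the left-hand side. *)
Definition yang_baxter (K : comNzRingType) (r wy wx : vweight K) :=
  forall a b i a2 b2 k : state,
  \sum_(a1 : state) \sum_(b1 : state) \sum_(m : state)
    r b a b1 a1 * wy i a1 m a2 * wx m b1 k b2
  = \sum_(a1 : state) \sum_(b1 : state) \sum_(m : state)
    wx i b m b1 * wy m a k a1 * r b1 a1 b2 a2.

(** The Izergin-Korepin weight multiplied by its common denominator
(x - q^2 y)(x - q^3 y): a polynomial in q, x, y, homogeneous of degree 2 in
(x, y). *)
Definition ik_num (K : comNzRingType) (q x y : K) : vweight K :=
  fun i j k l =>
  let d := x - q ^+ 2 * y in
  let e := x - q ^+ 3 * y in
   match i, j, k, l with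
   | 0%N, 0%N, 0%N, 0%N | 2%N, 2%N, 2%N, 2%N => d * e
   | 1%N, 0%N, 1%N, 0%N | 2%N, 1%N, 2%N, 1%N => q ^+ 2 * (x - y) * e
   | 1%N, 0%N, 0%N, 1%N | 2%N, 1%N, 1%N, 2%N => (1 - q ^+ 2) * x * e
   | 0%N, 1%N, 1%N, 0%N | 1%N, 2%N, 2%N, 1%N => (1 - q ^+ 2) * y * e
   | 0%N, 1%N, 0%N, 1%N | 1%N, 2%N, 1%N, 2%N => (x - y) * e
   | 2%N, 0%N, 2%N, 0%N => q ^+ 4 * (x - y) * (x - q * y)
   | 2%N, 0%N, 1%N, 1%N =>
       - (q * (1 - q) ^+ 2 * (1 + q) * x * (x - y))
   | 2%N, 0%N, 0%N, 2%N =>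
       (1 - q ^+ 2) * x * (x + q * x - q * y - q ^+ 3 * y)
   | 1%N, 1%N, 2%N, 0%N => - (q ^+ 4 * (1 + q) * (x - y) * y)
   | 1%N, 1%N, 1%N, 1%N =>
       - (q * x ^+ 2) + (1 + q) * (1 - q ^+ 2 + q ^+ 4) * x * y
        - q ^+ 4 * y ^+ 2
   | 1%N, 1%N, 0%N, 2%N => (1 + q) * x * (x - y)
   | 0%N, 2%N, 2%N, 0%N =>
       (1 - q ^+ 2) * (x + q ^+ 2 * x - q ^+ 2 * y - q ^+ 3 * y) * y
   | 0%N, 2%N, 1%N, 1%N => q * (1 - q) ^+ 2 * (1 + q) * (x - y) * y
   | 0%N, 2%N, 0%N, 2%N => (x - y) * (x - q * y)
   | _, _, _, _ => 0
   end.

Lemma sum_state (V : nmodType) (F : nat -> V) :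
  \sum_(v : state) F v = F 0%N + F 1%N + F 2%N.
Proof. by rewrite !big_ord_recl big_ord0 /= addr0 addrA. Qed.

Lemma ik_num_conserving (K : comNzRingType) (q x y : K) : conserving (ik_num q x y).
Proof.
move=> [i hi] [j hj] [k hk] [l hl] /=.
move: i j k l hi hj hk hl => [|[|[|i]]] // [|[|[|j]]] // [|[|[|k]]] // [|[|[|l]]] // _ _ _ _;
  by rewrite /= ?eqxx.
Qed.

(** A horizontal line of parameter 1/y appears through the homogeneous pair
(1, y z), so that y = 0 is allowed. *)
Lemma ik_num_yang_baxter (K : comNzRingType) (q x y z : K) :
  yang_baxter (ik_num q 1 (x * y)) (ik_num q 1 (y * z)) (ik_num q x z).
Proof.
move=> a b i a2 b2 k.
(* Both sides vanish unless the states are conserved: 141 identities remain. *)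
have [E|NE] := eqVneq (a + b + i)%N (a2 + b2 + k)%N; last first.
  rewrite big1 => [|a1 _]; last first.
    rewrite big1 // => b1 _; rewrite big1 // => m _.
    apply/eqP; apply/contraNT: NE => /mul_neq0[/mul_neq0[]].
    move=> /ik_num_conserving E1 /ik_num_conserving E2 /ik_num_conserving E3.
    by apply/eqP; lia.
  rewrite big1 // => a1 _; rewrite big1 // => b1 _; rewrite big1 // => m _.
  apply/eqP; apply/contraNT: NE => /mul_neq0[/mul_neq0[]].
  move=> /ik_num_conserving E1 /ik_num_conserving E2 /ik_num_conserving E3.
  by apply/eqP; lia.
pose L (a b i a2 b2 k a1 b1 m : nat) := ik_num q 1 (x * y) b a b1 a1
  * ik_num q 1 (y * z) i a1 m a2 * ik_num q x z m b1 k b2.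
pose R (a b i a2 b2 k a1 b1 m : nat) := ik_num q x z i b m b1
  * ik_num q 1 (y * z) m a k a1 * ik_num q 1 (x * y) b1 a1 b2 a2.
pose S3 (F : nat -> K) := F 0%N + F 1%N + F 2%N.
have S3E F : S3 F = \sum_(v : state) F v by rewrite sum_state.
transitivity (S3 (fun a1 => S3 (fun b1 => S3 (L a b i a2 b2 k a1 b1)))).
  rewrite S3E; apply: eq_bigr => a1 _.
  by rewrite S3E; apply: eq_bigr => b1 _; rewrite S3E.
transitivity (S3 (fun a1 => S3 (fun b1 => S3 (R a b i a2 b2 k a1 b1)))); last first.
  rewrite S3E; apply: eq_bigr => a1 _.
  by rewrite S3E; apply: eq_bigr => b1 _; rewrite S3E.
move: E (ltn_ord a) (ltn_ord b) (ltn_ord i) (ltn_ord a2) (ltn_ord b2) (ltn_ord k).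
move: (nat_of_ord a) (nat_of_ord b) (nat_of_ord i).
move: (nat_of_ord a2) (nat_of_ord b2) (nat_of_ord k).
case=> [|[|[|?]]] // [|[|[|?]]] // [|[|[|?]]] // [|[|[|?]]] // [|[|[|?]]] //
  [|[|[|?]]] // _ _ _ _ _ _ _;
  cbv [L R S3 ik_num]; ring.
Qed.

(** * Moving a row through a stack of rows *)

Lemma exchange_big3 (V : nmodType) (A B C D E F : finType)
    (f : A -> B -> C -> D -> E -> F -> V) :
  \sum_a \sum_b \sum_c \sum_d \sum_e \sum_g f a b c d e g
  = \sum_d \sum_e \sum_g \sum_a \sum_b \sum_c f a b c d e g.
Proof.
transitivity (\sum_(p : A * B * C) \sum_(r : D * E * F)
    f p.1.1 p.1.2 p.2 r.1.1 r.1.2 r.2).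
  rewrite pair_big pair_big /=; apply: eq_bigr => p _.
  by rewrite pair_big pair_big.
rewrite exchange_big /=; apply/esym.
rewrite pair_big pair_big /=; apply: eq_bigr => p _.
by rewrite pair_big pair_big.
Qed.

Lemma st0E : st0 = 0%N :> nat. Proof. by rewrite /st0 inordK. Qed.
Lemma st2E : st2 = 2%N :> nat. Proof. by rewrite /st2 inordK. Qed.

Section Cross.
Variable K : comNzRingType.
Implicit Types (w : vweight K) (ws rs : seq (vweight K)) (s t : seq state).

(** The operator that crosses one line successively with the lines of a stack,
with crossing weights [rs]: in [s] the line is above the stack, in [t] it is
below it. The states after those of the stack and the line are unchanged. *)
Fixpoint cross rs s t : K :=
  match rs, s, t with
  | [::], _, _ => (s == t)%:R
  | r :: rs', b :: s', a' :: b' :: t' =>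
      \sum_(c : state) cross rs' s' (c :: t') * r b c b' a'
  | _, _, _ => 0
  end.

(** The train argument for one column. *)
Lemma cross_column (prs : seq (vweight K * vweight K)) wy ws s t (i k : state) :
  every (fun p => yang_baxter p.1 wy p.2) prs ->
  size s = (size prs + size ws).+1 -> size t = (size prs + size ws).+1 ->
  \sum_(u : (size prs + size ws).+1.-tuple state)
     cross (map fst prs) s u * column (wy :: map snd prs ++ ws) u t i k
  = \sum_(u : (size prs + size ws).+1.-tuple state)
     column (map snd prs ++ wy :: ws) s u i k * cross (map fst prs) u t.
Proof.
elim: prs s t i k => [|[r wx] prs IH] s t i k.
  move=> _ ss st.
  transitivity (column (wy :: ws) s t i k).
    exact: (big_tuple_delta (fun u => column (wy :: ws) u t i k) ss).
  rewrite -(big_tuple_delta (fun u => column (wy :: ws) s u i k) st).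
  by apply: eq_bigr => u _; rewrite mulrC /= [_ == t]eq_sym.
case=> /= YB YBs.
case: s t => [|b s] // [|a2 [|b2 t]] // [ss] [st].
rewrite (big_tuple_cons _ (fun u => cross (r :: map fst prs) (b :: s) u *
  column (wy :: wx :: map snd prs ++ ws) u (a2 :: b2 :: t) i k)).
under [LHS]eq_bigr => a1 _ do rewrite (big_tuple_cons _ (fun u =>
  cross (r :: map fst prs) (b :: s) (a1 :: u) *
  column (wy :: wx :: map snd prs ++ ws) (a1 :: u) (a2 :: b2 :: t) i k)).
rewrite /=.
set n := (size prs + size ws)%N in IH ss st *.
(* The first row is treated by the Yang-Baxter equation, and the others by
induction. *)
pose X (c : state) u := cross (map fst prs) s (c :: u).
pose Y (u : seq state) (m : state) := column (map snd prs ++ ws) u t m k.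
transitivity (\sum_(c : state) \sum_(u : n.-tuple state) \sum_(m' : state)
   \sum_(a1 : state) \sum_(b1 : state) \sum_(m : state)
   X c u * Y u m' * (r b c b1 a1 * wy i a1 m a2 * wx m b1 m' b2)).
  rewrite exchange_big3; apply: eq_bigr => a1 _; apply: eq_bigr => b1 _.
  under eq_bigr => u _ do rewrite big_distrlr /=.
  rewrite exchange_big [RHS]exchange_big /=; apply: eq_bigr => c _.
  rewrite exchange_big /=; apply: eq_bigr => m _; apply: eq_bigr => u _.
  by rewrite !big_distrr /=; apply: eq_bigr => m' _; rewrite /X /Y; ring.
transitivity (\sum_(c : state) \sum_(u : n.-tuple state) \sum_(m' : state)
   \sum_(a1 : state) \sum_(b1 : state) \sum_(m : state)
   X c u * Y u m' * (wx i b m b1 * wy m c m' a1 * r b1 a1 b2 a2)).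
  apply: eq_bigr => c _; apply: eq_bigr => u _; apply: eq_bigr => m' _.
  transitivity (X c u * Y u m' * \sum_(a1 : state) \sum_(b1 : state)
      \sum_(m : state) r b c b1 a1 * wy i a1 m a2 * wx m b1 m' b2).
    by rewrite big_distrr; apply: eq_bigr => a1 _; rewrite big_distrr;
      apply: eq_bigr => b1 _; rewrite big_distrr.
  rewrite YB big_distrr; apply: eq_bigr => a1 _; rewrite big_distrr.
  by apply: eq_bigr => b1 _; rewrite big_distrr.
rewrite exchange_big3 (big_tuple_cons _ (fun u =>
  column (wx :: map snd prs ++ wy :: ws) (b :: s) u i k *
  cross (r :: map fst prs) u (a2 :: b2 :: t))) exchange_big /=.
apply: eq_bigr => b1 _.
transitivity (\sum_(a1 : state) \sum_(m : state) wx i b m b1 * r b1 a1 b2 a2 *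
  \sum_(v : n.+1.-tuple state) cross (map fst prs) s v *
     column (wy :: map snd prs ++ ws) v (a1 :: t) m k).
  apply: eq_bigr => a1 _; apply: eq_bigr => m _.
  rewrite (big_tuple_cons _ (fun v => cross (map fst prs) s v *
     column (wy :: map snd prs ++ ws) v (a1 :: t) m k)) big_distrr /=.
  apply: eq_bigr => c _; rewrite big_distrr; apply: eq_bigr => u _ /=.
  rewrite !big_distrr; apply: eq_bigr => m' _; rewrite /X /Y /=; ring.
under [LHS]eq_bigr => a1 _ do under eq_bigr => m _ do 
  rewrite (IH _ (a1 :: t) _ _ YBs ss (congr1 S st)) mulr_sumr.
under [LHS]eq_bigr do rewrite exchange_big.
rewrite exchange_big; apply: eq_bigr => v _.
rewrite big_distrlr exchange_big /=.
by apply: eq_bigr => m _; apply: eq_bigr => a1 _; ring.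
Qed.

Lemma cross_grid (prs : seq (vweight K * vweight K)) (pk : nat -> seq (vweight K * vweight K))
    (wy : nat -> vweight K) (ws : nat -> seq (vweight K)) bot top ks m s t :
  (forall k, map fst (pk k) = map fst prs) ->
  (forall k, every (fun p => yang_baxter p.1 (wy k) p.2) (pk k)) ->
  (forall k, (size prs + size (ws k)).+1 = m) -> size s = m -> size t = m ->
  \sum_(u : m.-tuple state)
     cross (map fst prs) s u
     * grid m (fun k => wy k :: map snd (pk k) ++ ws k) bot top ks u t
  = \sum_(u : m.-tuple state)
     grid m (fun k => map snd (pk k) ++ wy k :: ws k) bot top ks s u
     * cross (map fst prs) u t.
Proof.
move=> Epk YB Em; elim: ks s => [|k ks IH] s ss st /=.
  rewrite (big_tuple_delta (fun u => cross (map fst prs) u t) ss).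
  rewrite -(big_tuple_delta (fun u => cross (map fst prs) s u) st).
  by apply: eq_bigr => u _; rewrite mulrC /= [_ == t]eq_sym.
under [LHS]eq_bigr do rewrite mulr_sumr.
under [RHS]eq_bigr do rewrite mulr_suml.
rewrite exchange_big [RHS]exchange_big /=.
transitivity (\sum_(v : m.-tuple state) (\sum_(u : m.-tuple state)
   column (map snd (pk k) ++ wy k :: ws k) s u (bot k) (top k) * cross (map fst prs) u v) *
     grid m (fun k => wy k :: map snd (pk k) ++ ws k) bot top ks v t).
  apply: eq_bigr => v _.
  have szk : size (pk k) = size prs.
    by rewrite -(size_map fst) Epk size_map.
  have Ek := Em k; rewrite -szk in Ek.
  have sv : size v = m by rewrite size_tuple.
  have := @cross_column (pk k) (wy k) (ws k) s v (bot k) (top k) (YB k).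
  rewrite Epk Ek => <- //; rewrite mulr_suml.
  by apply: eq_bigr => u _; rewrite mulrA.
under [LHS]eq_bigr do rewrite mulr_suml.
rewrite exchange_big /=; apply: eq_bigr => u _.
transitivity (column (map snd (pk k) ++ wy k :: ws k) s u (bot k) (top k) *
  \sum_(v : m.-tuple state) cross (map fst prs) u v *
     grid m (fun k => wy k :: map snd (pk k) ++ ws k) bot top ks v t).
  by rewrite mulr_sumr; apply: eq_bigr => v _; rewrite mulrA.
rewrite IH ?size_tuple // mulr_sumr.
by apply: eq_bigr => v _; rewrite mulrA.
Qed.

Lemma cross_conserve rs s t :
  every (@conserving K) rs -> cross rs s t != 0 -> flow s = flow t.
Proof.
elim: rs s t => [|r rs IH] s t /=.
  by move=> _; case: (s =P t) => [->|]; rewrite ?eqxx.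
case: s t => [|b s] [|a' [|b' t]]; rewrite ?eqxx // => -[Hr Hrs].
case/sum_neq0 => c /mul_neq0[/(IH _ _ Hrs) E1 /Hr E2].
by move: E1 E2; rewrite /flow /=; lia.
Qed.

(** A stack and a line that all carry 2 leave the crossing in state 2. *)
Lemma cross_frozen rs s t : every (@conserving K) rs ->
  cross rs (nseq (size rs) st2 ++ st2 :: s) t
  = foldr (fun (r : vweight K) p => p * r 2%N 2%N 2%N 2%N) 1 rs
    * (t == nseq (size rs) st2 ++ st2 :: s)%:R.
Proof.
elim: rs t => [|r rs IH] t /=; first by rewrite mul1r eq_sym.
case: t => [|a' [|b' t]] [Hr Hrs]; rewrite ?mulr0 //.
  by rewrite eqseq_cons; case: (rs) => [|? ?]; rewrite andbF mulr0.
rewrite (bigD1 st2) //= big1 ?addr0; last first.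
  by move=> c c2; rewrite IH //; case: (rs) => [|? ?] /=;
    rewrite eqseq_cons (negPf c2) mulr0 mul0r.
rewrite IH // st2E.
have E : ([:: a', b' & t] == st2 :: nseq (size rs) st2 ++ st2 :: s)
  = [&& a' == st2, b' == st2 & st2 :: t == nseq (size rs) st2 ++ st2 :: s].
  by rewrite eqseq_cons; congr andb; case: (size rs) => [|n]; rewrite /= !eqseq_cons eqxx.
have E2 : r 2%N 2%N b' a' = r 2%N 2%N 2%N 2%N * ((a' == st2) && (b' == st2))%:R.
  have [/andP[/eqP-> /eqP->]|H] := boolP (_ && _); first by rewrite st2E mulr1.
  rewrite mulr0; apply/eqP; apply/contraNT: H.
  have := Hr st2 st2 b' a'; rewrite st2E => Hr' /Hr' /=.
  have := ltn_ord a'; have := ltn_ord b' => b3 a3 E'.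
  by rewrite -!val_eqE /= !st2E; lia.
rewrite E E2 andbA; case: (_ && _); rewrite /= ?mulr0 ?mulr1 //; ring.
Qed.

(** The diagonal coefficient of the crossing operator when the stack carries 0
and the line carries 2. *)
Lemma cross_unchanged rs s : every (@conserving K) rs ->
  cross rs (nseq (size rs) st0 ++ st2 :: s) (st2 :: nseq (size rs) st0 ++ s)
  = foldr (fun (r : vweight K) p => p * r 0%N 2%N 0%N 2%N) 1 rs.
Proof.
elim: rs => [|r rs IH] /=; first by rewrite eqxx.
case=> Hr Hrs; rewrite (bigD1 st2) //= IH // big1 ?addr0 ?st0E ?st2E //.
move=> c c2; apply/eqP; apply/contraNT: c2 => /mul_neq0[_ ].
have := Hr st0 c st0 st2; rewrite st0E st2E => H /H E.
by rewrite -val_eqE /= st2E; lia.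
Qed.

End Cross.

(** * Boundary conditions and reflection *)

Section Boundary.
Variable K : comNzRingType.

(** With a zero bottom boundary, a lowest row that ends in state 2 carries 2
all along, and it does not interact with the other rows. *)
Lemma grid_frozen m (wy : nat -> vweight K) (ws : nat -> seq (vweight K))
    bot top ks (a : state) s t :
  {in ks, forall k, [/\ bot k = st0, conserving (wy k)
                      & wy k 0%N 2%N 0%N 2%N = 1]} ->
  grid m.+1 (fun k => wy k :: ws k) bot top ks (a :: s) (st2 :: t)
  = (a == st2)%:R * grid m ws bot top ks s t.
Proof.
elim: ks a s => [|k ks IH] a s H /=.
  by rewrite eqseq_cons -natrM mulnb.
have [b0 Hw w1] := H k (mem_head _ _).
have {}IH a' s' : grid m.+1 (fun k => wy k :: ws k) bot top ks (a' :: s') (st2 :: t)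
  = (a' == st2)%:R * grid m ws bot top ks s' t.
  by apply: IH => k' k's; apply: H; rewrite inE k's orbT.
rewrite (big_tuple_cons _ (fun u => column (wy k :: ws k) (a :: s) u (bot k) (top k)
  * grid m.+1 (fun k => wy k :: ws k) bot top ks u (st2 :: t))).
rewrite (bigD1 st2) //= [X in _ + X]big1 ?addr0; last first.
  by move=> c c2; rewrite big1 // => u _; rewrite IH (negPf c2) mul0r mulr0.
rewrite mulr_sumr; apply: eq_bigr => u _; rewrite IH eqxx mul1r mulrA.
congr (_ * _); rewrite b0 st0E st2E.
rewrite (bigD1 st0) //= big1 ?addr0; last first.
  move=> v v0; apply/eqP; apply/contraNT: v0 => /mul_neq0[nz _].
  have := Hw st0 a v st2; rewrite st0E st2E => /(_ nz) E.
  by rewrite -val_eqE /= st0E; have := ltn_ord a; lia.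
congr (_ * _); rewrite st0E; have [->|a2] := eqVneq a st2; first by rewrite st2E.
apply/eqP; apply/contraNT: a2 => nz.
have := Hw st0 a st0 st2; rewrite st0E st2E => /(_ nz) E.
by rewrite -val_eqE /= st2E; have := st0E; lia.
Qed.

(** Weights for which an empty region contributes 1. *)
Definition vacuum_one (w : vweight K) := conserving w /\ w 0%N 0%N 0%N 0%N = 1.

Lemma column_vacuum ws s b : every vacuum_one ws ->
  column ws s (nseq (size ws) st0) b st0
  = ((b == st0) && (s == nseq (size ws) st0))%:R :> K.
Proof.
elim: ws s b => [|w ws IH] [|a s] b /=; rewrite ?andbT ?andbF //.
case=> -[Hw w1] Hws; rewrite (bigD1 st0) //= big1 ?addr0; last first.
  by move=> v v0; rewrite IH // (negPf v0) mulr0.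
rewrite IH // eqxx eqseq_cons andbA /= st0E.
rewrite (_ : w b a 0%N 0%N = ((b == st0) && (a == st0))%:R) -?natrM ?mulnb //.
have [/andP[/eqP-> /eqP->]|H] := boolP (_ && _); first by rewrite st0E w1.
apply/eqP; apply/contraNT: H => nz.
have := Hw b a st0 st0; rewrite st0E => /(_ nz) E.
by rewrite -!val_eqE /= st0E; lia.
Qed.

(** Columns with zero bottom, top and right boundaries are empty. *)
Lemma grid_vacuum m (ws : nat -> seq (vweight K)) bot top ks s : size s = m ->
  {in ks, forall k, [/\ bot k = st0, top k = st0, size (ws k) = m
                     & every vacuum_one (ws k)]} ->
  grid m ws bot top ks s (nseq m st0) = (s == nseq m st0)%:R.
Proof.
elim: ks s => [|k ks IH] s sm H //=.
have [b0 t0 szk Hk] := H k (mem_head _ _).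
have sm0 : size (nseq m st0) = m by rewrite size_nseq.
transitivity (column (ws k) s (nseq m st0) (bot k) (top k)); last first.
  by rewrite -{1}szk b0 t0 column_vacuum // eqxx szk.
rewrite -(big_tuple_delta (fun u => column (ws k) s u (bot k) (top k)) sm0).
apply: eq_bigr => u _; rewrite IH ?size_tuple; first by rewrite mulrC eq_sym.
  by [].
by move=> k' k's; apply: H; rewrite inE k's orbT.
Qed.

(** Adding empty columns on the right changes nothing. *)
Lemma grid_pad m (ws : nat -> seq (vweight K)) bot top L1 L2 s :
  (L1 <= L2)%N -> size s = m ->
  (forall k, (L1 <= k)%N -> [/\ bot k = st0, top k = st0, size (ws k) = m
                     & every vacuum_one (ws k)]) ->
  grid m ws bot top (iota 0 L2) s (nseq m st0)
  = grid m ws bot top (iota 0 L1) s (nseq m st0).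
Proof.
move=> le12 ss H; rewrite -(subnKC le12) iotaD grid_cat // add0n.
rewrite -(big_tuple_delta (fun u => grid _ _ _ _ _ _ u) (size_nseq m st0)).
apply: eq_bigr => u _; rewrite mulrC eq_sym; congr (_ * _).
by rewrite grid_vacuum ?size_tuple // => k; rewrite mem_iota => /andP[/H].
Qed.

(** Reflection of a column in a horizontal axis, combined with the complement
j -> 2 - j of the horizontal states. [V] is the gauge of the vertical edges, and
[H], [H'] are those of the edges on the left and on the right. *)
Lemma column_flip (pw : seq (vweight K * vweight K)) (V H H' : state -> K) s t b p :
  every (fun x : vweight K * vweight K => forall i j k l : state,
    x.1 i j k l * V i * H j = x.2 k (rev_ord j) i (rev_ord l) * V k * H' l) pw ->
  size s = size pw -> size t = size pw ->
  column (map fst pw) s t b p * V b * \prod_(a <- s) H a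
  = column (rev (map snd pw)) (rev (map (@rev_ord 3) s)) (rev (map (@rev_ord 3) t)) p b
    * V p * \prod_(a <- t) H' a.
Proof.
elim: pw s t b => [|[w w'] pw IH] [|a s] [|a' t] b //=.
  by rewrite !big_nil !mulr1 eq_sym; case: (p =P b) => [->|]; rewrite ?mul0r.
case=> Hw Hpw [ss] [st]; rewrite !rev_cons -!cats1 column_cat; last 2 first.
- by rewrite !size_rev !size_map.
- by rewrite !size_rev !size_map.
rewrite !big_cons !mulr_suml; apply: eq_bigr => v _ /=.
rewrite (bigD1 b) //= eqxx mulr1 [X in _ + X]big1 ?addr0; last first.
  by move=> c cb; rewrite (negPf cb) mulr0.
transitivity (w b a v a' * V b * H a * (column (map fst pw) s t v p * \prod_(a <- s) H a)).
  by ring.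
rewrite Hw.
transitivity (w' v (rev_ord a) b (rev_ord a') * H' a' *
   (column (map fst pw) s t v p * V v * \prod_(a <- s) H a)); first by ring.
by rewrite IH //; ring.
Qed.

Lemma grid_flip m (pw : nat -> seq (vweight K * vweight K)) (V H : nat -> state -> K)
    bot top k0 n s t :
  (forall c, every (fun x : vweight K * vweight K => forall i j k l : state,
    x.1 i j k l * V c i * H c j
    = x.2 k (rev_ord j) i (rev_ord l) * V c k * H c.+1 l) (pw c)) ->
  (forall c, size (pw c) = m) -> size s = m -> size t = m ->
  grid m (fun c => map fst (pw c)) bot top (iota k0 n) s t
    * \prod_(c <- iota k0 n) V c (bot c) * \prod_(a <- s) H k0 a
  = grid m (fun c => rev (map snd (pw c))) top bot (iota k0 n)
      (rev (map (@rev_ord 3) s)) (rev (map (@rev_ord 3) t))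
    * \prod_(c <- iota k0 n) V c (top c) * \prod_(a <- t) H (k0 + n)%N a.
Proof.
move=> Hpw Em; elim: n k0 s => [|n IH] k0 s ss st /=.
  rewrite !big_nil addn0 !mulr1.
  rewrite (inj_eq (can_inj revK)) (inj_eq (inj_map (@rev_ord_inj 3))).
  by case: (s =P t) => [->|]; rewrite ?mul0r.
rewrite !big_cons.
pose f (u : m.-tuple state) := [tuple of rev (map (@rev_ord 3) u)].
have fK : involutive f.
  move=> u; apply/val_inj; rewrite /= map_rev revK -map_comp.
  by rewrite -[RHS]map_id; apply: eq_map => i /=; rewrite rev_ordK.
rewrite [in RHS](reindex_inj (inv_inj fK)) /= !mulr_suml; apply: eq_bigr => u _.
have := @column_flip (pw k0) (V k0) (H k0) (H k0.+1) s u (bot k0) (top k0) (Hpw k0).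
rewrite Em size_tuple => /(_ ss erefl) E1.
have := IH k0.+1 u (size_tuple u) st; rewrite addSnnS => E2.
transitivity ((column (map fst (pw k0)) s u (bot k0) (top k0) * V k0 (bot k0) *
    \prod_(a <- s) H k0 a) *
   (grid m (fun c => map fst (pw c)) bot top (iota k0.+1 n) u t *
      \prod_(c <- iota k0.+1 n) V c (bot c))); first by ring.
rewrite E1.
transitivity (column (rev (map snd (pw k0))) (rev (map (@rev_ord 3) s))
      (rev (map (@rev_ord 3) u)) (top k0) (bot k0) * V k0 (top k0) *
   (grid m (fun c => map fst (pw c)) bot top (iota k0.+1 n) u t *
      \prod_(c <- iota k0.+1 n) V c (bot c) * \prod_(a <- u) H k0.+1 a)).
  by ring.
by rewrite E2; ring.
Qed.

End Boundary.

Section Norm.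
Variable K : numDomainType.

(** The absolute values of a vertex weight. *)
Definition abs_weight (w : vweight K) : vweight K := fun i j k l => `|w i j k l|.

Lemma norm_column ws s t b p :
  `|column ws s t b p| <= column (map abs_weight ws) s t b p.
Proof.
elim: ws s t b => [|w ws IH] [|a s] [|a' t] b /=; rewrite ?normr0 ?normr_nat //.
apply: le_trans (ler_norm_sum _ _ _) _; apply: ler_sum => v _.
by rewrite normrM ler_wpM2l.
Qed.

Lemma norm_grid m (ws : nat -> seq (vweight K)) bot top ks s t :
  `|grid m ws bot top ks s t| <= grid m (fun k => map abs_weight (ws k)) bot top ks s t.
Proof.
elim: ks s => [|k ks IH] s /=; first by rewrite normr_nat.
apply: le_trans (ler_norm_sum _ _ _) _; apply: ler_sum => u _.
by rewrite normrM ler_pM // norm_column.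
Qed.

Lemma abs_weight_conserving w : conserving w -> conserving (abs_weight w).
Proof. by move=> H i j k l; rewrite /abs_weight normr_eq0; exact: H. Qed.

End Norm.

(** * Triangularity of the column kernels *)

(** The sum of the partial sums of a list of states. It decreases when a state
moves to a later (higher) row. *)
Fixpoint potential (s : seq state) : nat :=
  if s is a :: s' then ((size s').+1 * a + potential s')%N else 0%N.

Lemma potential_cat s t : potential (s ++ t) = (potential s + size t * flow s + potential t)%N.
Proof.
elim: s => [|a s IH] /=; first by rewrite muln0.
by rewrite IH size_cat /flow /=; lia.
Qed.

Lemma flow_cat s t : flow (s ++ t) = (flow s + flow t)%N.
Proof. by rewrite /flow map_cat sumn_cat. Qed.

Lemma flow_nseq n a : flow (nseq n a) = (a * n)%N.
Proof. by rewrite /flow map_nseq sumn_nseq mulnC. Qed.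

Lemma potential_nseq0 n : potential (nseq n st0) = 0%N.
Proof. by elim: n => //= n ->; rewrite st0E muln0. Qed.

Lemma flow_le s : (flow s <= 2 * size s)%N.
Proof.
elim: s => //= a s; rewrite /flow /=; have := ltn_ord a; lia.
Qed.

(** For an even flow the bound is attained by states 2 on top of states 0. *)
Lemma potential_min s : (flow s * (flow s + 2) <= 4 * potential s)%N.
Proof.
elim: s => [|a s IH] //=; have := flow_le s; move: IH.
rewrite /flow /= -/(flow s); case: a => [[|[|[|]]] //] /= _; nia.
Qed.

Section Pot.
Variable K : comNzRingType.

(** If the bottom edge is empty, the potential does not increase from left to
right, and it is unchanged only if nothing moves. *)
Lemma column_potential (ws : seq (vweight K)) s t (b p : state) :
  every (@conserving K) ws -> column ws s t b p != 0 ->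
  (potential t <= potential s + size ws * b)%N /\
  ((potential s + size ws * b <= potential t)%N -> b = 0%N :> nat -> s = t).
Proof.
elim: ws s t b => [|w ws IH] [|a s] [|a' t] b /=; rewrite ?eqxx //.
case=> Hw Hws /sum_neq0[v /mul_neq0[/Hw E nz]].
have [E1 E2] := column_size nz; have [L1 L2] := IH _ _ _ Hws nz.
rewrite E1 E2; split; first by nia.
move=> L3 b0.
have v0 : v = 0%N :> nat by nia.
congr cons; first by apply/val_inj => /=; lia.
by apply: L2 => //; nia.
Qed.

(** The product of the weights of a column in which nothing moves. *)
Fixpoint diagonal (ws : seq (vweight K)) (s : seq state) : K :=
  match ws, s with
  | w :: ws', a :: s' => w 0%N a 0%N a * diagonal ws' s'
  | _, _ => 1
  end.

Lemma column_diagonal ws s : every (@conserving K) ws -> size s = size ws ->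
  column ws s s st0 st0 = diagonal ws s.
Proof.
elim: ws s => [|w ws IH] [|a s] //=; first by rewrite eqxx.
case=> Hw Hws [ss]; rewrite (bigD1 st0) //= big1 ?addr0; first by rewrite IH // st0E.
move=> v v0; apply/eqP; apply/contraNT: v0 => /mul_neq0[/Hw E _].
by rewrite -val_eqE /=; move: E; rewrite st0E; lia.
Qed.

Lemma diagonal_cat ws1 ws2 s1 s2 : size s1 = size ws1 ->
  diagonal (ws1 ++ ws2) (s1 ++ s2) = diagonal ws1 s1 * diagonal ws2 s2.
Proof.
elim: ws1 s1 => [|w ws1 IH] [|a s1] //=; first by rewrite mul1r.
by case=> ss; rewrite IH // mulrA.
Qed.

(** The entries of [xs] in the rows where the state is [n]. *)
Definition select (n : nat) (s : seq state) (xs : seq K) :=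
  mask [seq a == n :> nat | a : state <- s] xs.

(** If the rows in state [o] have weight 1, only those in states 1 and 2 - o
contribute to the diagonal entry. *)
Lemma diagonal_select (ws : seq (vweight K)) s (o : nat) : o \in [:: 0; 2]%N ->
  every (fun w => w 0%N o 0%N o = 1) ws -> size s = size ws ->
  diagonal ws s = \prod_(x <- select 1 s [seq w 0%N 1%N 0%N 1%N | w <- ws]) x
    * \prod_(x <- select (2 - o) s [seq w 0%N (2 - o)%N 0%N (2 - o)%N | w <- ws]) x :> K.
Proof.
move=> o3; elim: ws s => [|w ws IH] [|a s] //=; first by rewrite !big_nil mulr1.
case=> w1 Hws [ss]; rewrite /select /= IH //.
case: a => a a3 /=; case: o o3 w1 {IH Hws} => [|[|[|]]] // _ w1;
  case: a a3 => [|[|[|]]] //= _; rewrite ?big_cons ?w1 /select /=; ring.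
Qed.

End Pot.

(** * Pairing of the diagonal ratios *)

Section Pairing.
Variable K : numDomainType.

(** A product of ratios over balanced rows contracts. Here [X1], [X2] are the
ratios of the first kind of rows in states 1 and 2, and [Y1], [Y2] those of the
second kind; balance allows one to split the product into pairs X1 Y1 and X2 Y2
and triples X2 Y1 Y1 and Y2 X1 X1, each bounded by [eps]. *)
Lemma pairing (eps : K) (X1 X2 Y1 Y2 : seq K) : 0 <= eps -> eps <= 1 ->
  all (fun x => 0 <= x) (X1 ++ X2 ++ Y1 ++ Y2) ->
  (size X1 + 2 * size X2 = size Y1 + 2 * size Y2)%N ->
  allrel (fun a b => a * b <= eps) X1 Y1 ->
  allrel (fun a b => a * b <= eps) X2 Y2 ->
  all (fun a => pairwise (fun b b' => a * (b * b') <= eps) Y1) X2 ->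
  all (fun b => pairwise (fun a a' => b * (a * a') <= eps) X1) Y2 ->
  \prod_(x <- X1) x * \prod_(x <- X2) x * (\prod_(x <- Y1) x * \prod_(x <- Y2) x)
    <= (if (size X1 + size X2)%N == 0%N then 1 else eps).
Proof.
move=> e0 e1.
have [n] := ubnP (size X1 + size X2 + size Y1 + size Y2)%N.
elim: n X1 X2 Y1 Y2 => // n IH X1 X2 Y1 Y2 ltn.
rewrite !all_cat => /and4P[pX1 pX2 pY1 pY2] Es r1 r2 rX rY.
have pos (X : seq K) : all (fun x => 0 <= x) X -> 0 <= \prod_(x <- X) x.
  elim: X => [|x X IHX] /=; first by rewrite big_nil ler01.
  by rewrite big_cons => /andP[? /IHX]; exact: mulr_ge0.
have close (x p q : K) : 0 <= x <= eps -> p <= 1 -> q = x * p -> q <= eps.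
  move=> /andP[x0 xe] p1 ->; apply: le_trans xe.
  by rewrite -[leRHS]mulr1 ler_wpM2l.
have weak c : (if c : bool then 1 else eps) <= 1 by case: c.
have weaken p c : p <= (if c : bool then 1 else eps) -> p <= 1.
  by move=> h; apply: le_trans h _; case: c.
(* A pair X1 Y1 or X2 Y2 is removed if there is one; otherwise balance provides
a triple. *)
case: X1 ltn pX1 Es r1 rY => [|a X1] ltn pX1 Es r1 rY.
  case: X2 ltn pX2 Es r2 rX => [|c X2] ltn pX2 Es r2 rX.
    case: Y1 Y2 Es {ltn pY1 pY2 r1 r2 rX rY} => [|? ?] [|? ?] //= _.
    by rewrite !big_nil !mulr1.
  case: Y2 ltn pY2 Es r2 rY => [|d Y2] ltn pY2 Es r2 rY.
    case: Y1 ltn pY1 Es r1 rX => [|b [|b' Y1]] ltn pY1 Es r1 rX.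
    - by move: Es; clear => /=; lia.
    - by move: Es; clear => /=; lia.
    move: pX2 pY1 => /= /andP[c0 pX2] /and3P[b0 b'0 pY1].
    move: rX => /= /andP[/andP[/andP[r _] _] rX].
    apply: (close (c * (b * b')) _ _ _ (weaken _ _ (IH [::] X2 Y1 [::] _ _ _ _ _ _ _))).
    - by rewrite r !mulr_ge0.
    - by move: ltn; clear => /=; lia.
    - by rewrite !all_cat pX2 pY1.
    - by move: Es; clear => /=; lia.
    - by rewrite /allrel.
    - by rewrite allrel0r.
    - by apply/allP => x /(allP rX) /= /andP[_ /andP[_]].
    - by [].
    - by rewrite !big_cons !big_nil; ring.
  move: pX2 pY2 => /= /andP[c0 pX2] /andP[d0 pY2].
  move: r2; rewrite allrel_cons2 => /and4P[r _ _ r2].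
  apply: (close (c * d) _ _ _ (weaken _ _ (IH [::] X2 Y1 Y2 _ _ _ _ _ _ _))).
  - by rewrite r !mulr_ge0.
  - by move: ltn; clear => /=; lia.
  - by rewrite !all_cat pX2 pY1.
  - by move: Es; clear => /=; lia.
  - by rewrite /allrel.
  - by [].
  - by move: rX => /= /andP[].
  - by apply/allP.
  - by rewrite !big_cons !big_nil; ring.
case: Y1 ltn pY1 Es r1 rX => [|b Y1] ltn pY1 Es r1 rX; last first.
  move: pX1 pY1 => /= /andP[a0 pX1] /andP[b0 pY1].
  move: r1; rewrite allrel_cons2 => /and4P[r _ _ r1].
  apply: (close (a * b) _ _ _ (weaken _ _ (IH X1 X2 Y1 Y2 _ _ _ _ _ _ _))).
  - by rewrite r !mulr_ge0.
  - by move: ltn; clear => /=; lia.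
  - by rewrite !all_cat pX1 pX2 pY1.
  - by move: Es; clear => /=; lia.
  - by [].
  - by [].
  - by apply/allP => x /(allP rX) /= /andP[].
  - by apply/allP => x /(allP rY) /= /andP[].
  - by rewrite !big_cons; ring.
case: Y2 ltn pY2 Es r2 rY => [|d Y2] ltn pY2 Es r2 rY.
  by move: Es; clear => /=; lia.
case: X2 ltn pX2 Es r2 rX => [|c X2] ltn pX2 Es r2 rX; last first.
  move: pX2 pY2 => /= /andP[c0 pX2] /andP[d0 pY2].
  move: r2; rewrite allrel_cons2 => /and4P[r _ _ r2].
  apply: (close (c * d) _ _ _ (weaken _ false (IH (a :: X1) X2 [::] Y2 _ _ _ _ _ _ _))).
  - by rewrite r !mulr_ge0.
  - by move: ltn; clear => /=; lia.
  - by rewrite !all_cat pX1 pX2 pY2.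
  - by move: Es; clear => /=; lia.
  - by [].
  - by [].
  - by apply/allP.
  - by move: rY => /= /andP[].
  - by rewrite !big_cons !big_nil; ring.
case: X1 ltn pX1 Es r1 rY => [|a' X1] ltn pX1 Es r1 rY.
  by move: Es; clear => /=; lia.
move: pX1 pY2 => /= /and3P[a0 a'0 pX1] /andP[d0 pY2].
move: rY => /= /andP[/andP[/andP[r _] _] rY].
apply: (close (d * (a * a')) _ _ _ (weaken _ _ (IH X1 [::] [::] Y2 _ _ _ _ _ _ _))).
- by rewrite r !mulr_ge0.
- by move: ltn; clear => /=; lia.
- by rewrite !all_cat pX1 pY2.
- by move: Es; clear => /=; lia.
- by rewrite allrel0r.
- by [].
- by [].
- by apply/allP => x /(allP rY) /= /andP[_ /andP[_]].
- by rewrite !big_cons !big_nil; ring.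
Qed.

End Pairing.

(** * Geometric decay away from the ground state *)

Section Decay.
Variable K : numFieldType.

(** Nonnegative weights bounded by [B]. *)
Definition bounded_by (B : K) (w : vweight K) :=
  forall i j k l : state, 0 <= w i j k l <= B.

Lemma column_bound (B : K) ws s t b p : 0 <= B -> every (bounded_by B) ws ->
  0 <= column ws s t b p <= (3%:R * B) ^+ size ws.
Proof.
move=> B0; elim: ws s t b => [|w ws IH] [|a s] [|a' t] b /=;
  rewrite ?expr0 ?lexx ?ler01 ?exprn_ge0 ?mulr_ge0 ?ler0n //.
  by case: eqP; rewrite ?lexx ?ler01.
case=> Hw Hws; apply/andP; split.
  apply: sumr_ge0 => v _; apply: mulr_ge0.
    by case/andP: (Hw b a v a').
  by case/andP: (IH s t v Hws).
rewrite exprS -mulrA.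
have -> : 3%:R * (B * (3%:R * B) ^+ size ws) = \sum_(v : state) B * (3%:R * B) ^+ size ws.
  by rewrite sumr_const card_ord mulr_natl.
apply: ler_sum => v _; case/andP: (Hw b a v a') => w0 wB.
by case/andP: (IH s t v Hws) => c0 cB; apply: ler_pM.
Qed.

Lemma grid_ge0 (B : K) m (ws : nat -> seq (vweight K)) bot top ks s t : 0 <= B ->
  (forall k, every (bounded_by B) (ws k)) -> 0 <= grid m ws bot top ks s t.
Proof.
move=> B0 H; elim: ks s => [|k ks IH] s /=; first exact: ler0n.
apply: sumr_ge0 => u _; apply: mulr_ge0 => //.
by case/andP: (column_bound s u (bot k) (top k) B0 (H k)).
Qed.

Variables (m : nat) (ws : nat -> seq (vweight K)) (B eps eps' : K) (z0 : seq state).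
Hypotheses (size_ws : forall k, size (ws k) = m)
  (ws_conserving : forall k, every (@conserving K) (ws k))
  (B_ge0 : 0 <= B) (ws_bounded : forall k, every (bounded_by B) (ws k))
  (eps_ge0 : 0 <= eps) (lt_eps : eps < eps') (eps'_le1 : eps' <= 1)
  (size_z0 : size z0 = m)
  (z0_min : forall s, size s = m -> flow s = flow z0 -> (potential z0 <= potential s)%N)
  (ws_diag : forall k s, size s = m -> flow s = flow z0 ->
     diagonal (ws k) s <= if s == z0 then 1 else eps).

(** The bound carries the weight Lam^potential. The factor Lam is so large that
the transitions that lower the potential, at most 3^m of them, are absorbed by
the room between [eps] and [eps']. *)
Lemma decay_tail (Lam : K) bot top ks s e : 1 <= Lam ->
  (3 ^ m)%:R * (3%:R * B) ^+ m <= Lam * (eps' - eps) ->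
  {in ks, forall k, bot k = st0 /\ top k = st0} ->
  size s = m -> size e = m -> flow s = flow z0 -> flow e = flow z0 ->
  grid m ws bot top ks s e
  <= (if (s == z0) && (e != z0) then 0 else (if e == z0 then 1 else eps' ^+ size ks)
       * Lam ^+ potential s).
Proof.
move=> Lam1 HLam; have Lam0 : 0 <= Lam by apply: le_trans Lam1; apply: ler01.
have eps'0 : 0 <= eps' by apply: le_trans eps_ge0 (ltW lt_eps).
move=> + + se; elim: ks s => [|k ks IH] s Hk ss fs fe /=.
  have [->|ne] := eqVneq s e.
    by case: (e == z0); rewrite /= ?expr0 mul1r exprn_ege1.
  by case: (s == z0); case: (e == z0); rewrite /= ?expr0 ?mul1r ?exprn_ge0.
have [b0 t0] := Hk k (mem_head _ _); rewrite b0 t0.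
have {}IH u : size u = m -> flow u = flow z0 -> grid m ws bot top ks u e
  <= (if (u == z0) && (e != z0) then 0 else (if e == z0 then 1 else eps' ^+ size ks)
       * Lam ^+ potential u).
  by move=> su fu; apply: IH => // k' k's; apply: Hk; rewrite inE k's orbT.
set W := (if e == z0 then 1 else eps' ^+ size ks) in IH.
have W0 : 0 <= W by rewrite /W; case: ifP => _; rewrite ?ler01 ?exprn_ge0.
have IH' u : size u = m -> flow u = flow z0 -> grid m ws bot top ks u e
  <= W * Lam ^+ potential u.
  move=> su fu; apply: le_trans (IH u su fu) _.
  by case: ifP => // _; rewrite mulr_ge0 ?exprn_ge0.
have ge0 u : 0 <= grid m ws bot top ks u e by exact: (@grid_ge0 B).
have nz u : column (ws k) s u st0 st0 != 0 ->
    [/\ size u = m, flow u = flow z0 & u = s \/ (potential u < potential s)%N].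
  move=> nz; have [_ E] := column_size nz.
  have F := column_conserve (ws_conserving k) nz.
  have [P1 P2] := column_potential (ws_conserving k) nz.
  move: P1 P2; rewrite st0E muln0 addn0 => P1 P2; split.
  - by rewrite E size_ws.
  - by rewrite -fs; move: F; rewrite st0E !add0n.
  - by have [/P2/(_ erefl)->|lt] := leqP (potential s) (potential u); [left|right].
have diag : column (ws k) s s st0 st0 = diagonal (ws k) s by rewrite column_diagonal ?size_ws.
move: (ss) => /eqP ss'.
rewrite (bigD1 (Tuple ss')) //= diag.
(* From the ground state only the ground state can be reached. *)
have [sz|sz] := eqVneq s z0.
  rewrite big1 ?addr0 => [|u us].
    have := ws_diag k ss fs; rewrite sz eqxx => d1.
    have d0 : 0 <= diagonal (ws k) z0.
      rewrite -sz -diag; case/andP: (column_bound s s st0 st0 B_ge0 (ws_bounded k)) => //.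
    have := IH z0 size_z0 erefl; rewrite eqxx /=.
    case: ifP => [ez g0|/negbFE ez g1].
      have -> : grid m ws bot top ks z0 e = 0 by apply/eqP; rewrite eq_le g0 ge0.
      by rewrite mulr0.
    rewrite ez -[leRHS]mul1r; apply: ler_pM => //.
    by move: g1; rewrite /W ez.
  apply/eqP; rewrite mulf_eq0; apply/orP; left; apply/contraT => /nz[su fu].
  case=> [E|]; first by case/eqP: us; apply/val_inj.
  by rewrite sz ltnNge z0_min.
rewrite /=.
have -> : (if e == z0 then 1 else eps' ^+ (size ks).+1) * Lam ^+ potential s
  = (if e == z0 then 1 else eps') * (W * Lam ^+ potential s).
  by rewrite /W; case: ifP => _; rewrite ?mul1r // exprS mulrA.
have X0 : 0 <= W * Lam ^+ potential s by rewrite mulr_ge0 ?exprn_ge0.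
apply: (@le_trans _ _ (eps' * (W * Lam ^+ potential s))); last first.
  by apply: ler_wpM2r => //; case: ifP.
rewrite -[X in _ <= X * _](subrK eps) [_ - _ + _]addrC mulrDl; apply: lerD.
  have := ws_diag k ss fs; rewrite (negPf sz) => d1.
  apply: ler_pM => //; last exact: IH'.
  by rewrite -diag; case/andP: (column_bound s s st0 st0 B_ge0 (ws_bounded k)).
set T := (eps' - eps) * _.
have T0 : 0 <= T by rewrite mulr_ge0 // subr_ge0 ltW.
have E3 : #|{: m.-tuple state}| = (3 ^ m)%N by rewrite card_tuple card_ord.
apply: (@le_trans _ _ (\sum_(u : m.-tuple state) T / (3 ^ m)%:R)); last first.
  rewrite sumr_const E3 -[leLHS]mulr_natr divfK //.
  by rewrite pnatr_eq0 expn_eq0.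
apply: (@le_trans _ _ (\sum_(u : m.-tuple state | u != Tuple ss') T / (3 ^ m)%:R)).
  apply: ler_sum => u us.
  have Tm0 : 0 <= T / (3 ^ m)%:R by rewrite divr_ge0 ?ler0n.
  have [->|/nz[su fu]] := eqVneq (column (ws k) s u st0 st0) 0; first by rewrite mul0r.
  case=> [E|lt]; first by case/eqP: us; apply/val_inj.
  rewrite ler_pdivlMr ?ltr0n ?expn_gt0 //.
  have Lpos : 0 < Lam by apply: lt_le_trans Lam1; apply: ltr01.
  apply: (@le_trans _ _ ((3%:R * B) ^+ m * (W * Lam ^+ (potential s).-1) * (3 ^ m)%:R)).
    apply: ler_wpM2r; first exact: ler0n.
    case/andP: (column_bound s u st0 st0 B_ge0 (ws_bounded k)) => c0; rewrite size_ws => cB.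
    apply: ler_pM => //; apply: le_trans (IH' u su fu) _.
    by apply: ler_wpM2l => //; apply: ler_weXn2l => //; move: lt; clear; lia.
  have -> : T = (Lam * (eps' - eps)) * (W * Lam ^+ (potential s).-1).
    rewrite /T -{1}(prednK (leq_ltn_trans (leq0n _) lt)) exprS; ring.
  rewrite mulrAC; apply: ler_wpM2r; first by rewrite mulr_ge0 ?exprn_ge0.
  by rewrite mulrC.
rewrite [leRHS](bigD1 (Tuple ss')) //= lerDr divr_ge0 ?ler0n //.
Qed.

(** [D] does not depend on the number [n] of columns with a zero bottom and top. *)
Lemma decay N0 bot top s0 : size s0 = m ->
  (forall k, (N0 <= k)%N -> bot k = st0 /\ top k = st0) ->
  exists2 D : K, 0 <= D & forall n e, size e = m -> flow e = flow z0 ->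
    grid m ws bot top (iota 0 (N0 + n)) s0 e
    <= D * (if e == z0 then 1 else eps' ^+ n).
Proof.
move=> ss0 Hk.
have d0 : 0 < eps' - eps by rewrite subr_gt0.
pose Lam := 1 + (3 ^ m)%:R * (3%:R * B) ^+ m / (eps' - eps).
have h0 : 0 <= (3 ^ m)%:R * (3%:R * B) ^+ m by rewrite mulr_ge0 ?ler0n ?exprn_ge0 ?mulr_ge0 ?ler0n.
have Lam1 : 1 <= Lam by rewrite lerDl divr_ge0 // ltW.
have HLam : (3 ^ m)%:R * (3%:R * B) ^+ m <= Lam * (eps' - eps).
  by rewrite /Lam [leRHS]mulrDl mul1r divfK ?gt_eqF // lerDr ltW.
have Lam0 : 0 <= Lam by apply: le_trans Lam1; apply: ler01.
have eps'0 : 0 <= eps' by apply: le_trans eps_ge0 (ltW lt_eps).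
have g0 ks s t : 0 <= grid m ws bot top ks s t by exact: (@grid_ge0 B).
(* The first N0 columns, where the kernels need not contract, enter D. *)
exists (\sum_(u : m.-tuple state)
  grid m ws bot top (iota 0 N0) s0 u * Lam ^+ potential u).
  by apply: sumr_ge0 => u _; rewrite mulr_ge0 ?exprn_ge0.
move=> n e se fe; rewrite iotaD grid_cat // mulr_suml; apply: ler_sum => u _.
rewrite add0n -mulrA; apply: ler_wpM2l => //.
set W := if e == z0 then _ else _.
have W0 : 0 <= W by rewrite /W; case: ifP => _; rewrite ?ler01 ?exprn_ge0.
have X0 : 0 <= Lam ^+ potential u * W by rewrite mulr_ge0 ?exprn_ge0.
have [->//|nz] := eqVneq (grid m ws bot top (iota N0 n) u e) 0.
have Hk' : {in iota N0 n, forall k, bot k = st0 /\ top k = st0}.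
  by move=> k; rewrite mem_iota => /andP[/Hk].
have fu : flow u = flow z0.
  have := grid_conserve ws_conserving nz; rewrite -fe.
  have -> : (\sum_(k <- iota N0 n) bot k = 0)%N.
    by rewrite big_seq big1 // => k /Hk'[-> _]; rewrite st0E.
  have -> : (\sum_(k <- iota N0 n) top k = 0)%N.
    by rewrite big_seq big1 // => k /Hk'[_ ->]; rewrite st0E.
  by [].
have := decay_tail Lam1 HLam Hk' (size_tuple u) se fu fe.
rewrite size_iota -/W => h; apply: le_trans h _.
by case: ifP => // _; rewrite mulrC.
Qed.

End Decay.

(** * Crossed weights *)

Section Weights.
Variables (K : fieldType) (q : K).

(** The weight of a horizontal line of parameter 1/y, normalised so that
W(0,2;0,2) = 1. *)
Definition crossed (y z : K) : vweight K := fun i j k l =>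
  ik_num q 1 (y * z) i j k l / ((1 - y * z) * (1 - q * (y * z))).

Lemma ik_weight_num (x z : K) (i j k l : state) :
  x - q ^+ 2 * z != 0 -> x - q ^+ 3 * z != 0 ->
  ik_weight q x z i j k l
  = ik_num q x z i j k l / ((x - q ^+ 2 * z) * (x - q ^+ 3 * z)).
Proof.
move=> d0 e0.
case: i j k l => [[|[|[|i]]] // hi] [[|[|[|j]]] // hj] [[|[|[|k]]] // hk] [[|[|[|l]]] // hl];
  rewrite /= ?mul0r //; field; rewrite ?d0 ?e0 //.
Qed.

Lemma ik_weight_conserving (x z : K) : conserving (ik_weight q x z).
Proof.
move=> [i hi] [j hj] [k hk] [l hl] /=.
move: i j k l hi hj hk hl => [|[|[|i]]] // [|[|[|j]]] // [|[|[|k]]] // [|[|[|l]]] // _ _ _ _;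
  by rewrite /= ?eqxx.
Qed.

Lemma crossed_conserving (y z : K) : conserving (crossed y z).
Proof. by move=> i j k l /mul_neq0[/ik_num_conserving]. Qed.

Lemma crossed_0202 (y z : K) : 1 - y * z != 0 -> 1 - q * y * z != 0 ->
  crossed y z 0%N 2%N 0%N 2%N = 1.
Proof.
by move=> h1 h2; rewrite /crossed /= mulrA divff // mulf_neq0.
Qed.

Lemma yang_baxter_scale (r wy wx : vweight K) (wy' wx' : vweight K) (c d : K) :
  (forall i j k l : state, wy' i j k l = wy i j k l * c) ->
  (forall i j k l : state, wx' i j k l = wx i j k l * d) ->
  yang_baxter r wy wx -> yang_baxter r wy' wx'.
Proof.
move=> Ey Ex YB a b i a2 b2 k.
transitivity ((\sum_(a1 : state) \sum_(b1 : state) \sum_(m : state)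
    r b a b1 a1 * wy i a1 m a2 * wx m b1 k b2) * (c * d)).
  rewrite mulr_suml; apply: eq_bigr => a1 _; rewrite mulr_suml; apply: eq_bigr => b1 _.
  by rewrite mulr_suml; apply: eq_bigr => m _; rewrite Ey Ex; ring.
rewrite YB mulr_suml; apply: eq_bigr => a1 _; rewrite mulr_suml; apply: eq_bigr => b1 _.
by rewrite mulr_suml; apply: eq_bigr => m _; rewrite Ey Ex; ring.
Qed.

Lemma weights_yang_baxter (x y z : K) :
  x - q ^+ 2 * z != 0 -> x - q ^+ 3 * z != 0 ->
  yang_baxter (ik_num q 1 (x * y)) (crossed y z) (ik_weight q x z).
Proof.
move=> h1 h2; apply: (@yang_baxter_scale _ (ik_num q 1 (y * z)) (ik_num q x z)
  _ _ (((1 - y * z) * (1 - q * (y * z)))^-1)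
  (((x - q ^+ 2 * z) * (x - q ^+ 3 * z))^-1)) => //.
  by move=> i j k l; rewrite ik_weight_num.
exact: ik_num_yang_baxter.
Qed.

(** Gauge of the vertical edges of column [c] (numbered from 0). *)
Definition gauge (c : nat) (s : state) : K :=
  [:: 1; - (1 - q); - q]`_s / (q ^+ (2 * c.+1)) ^+ s.

(** Gauge of the horizontal edges on the left of column [c]. *)
Definition hgauge (c : nat) (s : state) : K := (q ^+ (2 * c)) ^+ (2 - s).

(** The crossing symmetry of the Izergin-Korepin weights. *)
Lemma crossed_symmetry (y z : K) c (i j k l : state) :
  q != 0 -> q != 1 -> z != 0 -> 1 - y * z != 0 -> 1 - q * y * z != 0 ->
  crossed y z i j k l * gauge c i * hgauge c j
  = ik_weight q y (q ^- 3 * z^-1) k (rev_ord j) i (rev_ord l)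
    * gauge c k * hgauge c.+1 l.
Proof.
move=> q0 q1 z0 h1 h2; rewrite /gauge /hgauge.
have -> : (2 * c.+1 = 2 * c + 2)%N by rewrite mulnS addnC.
rewrite exprD; set P := q ^+ (2 * c).
have P0 : P != 0 by rewrite expf_neq0.
have q1' : 1 - q != 0 by rewrite subr_eq0 eq_sym.
have E1 : y - q ^+ 2 * (q ^- 3 * z^-1) = - (1 - q * y * z) / (q * z) by field; rewrite q0 z0.
have E2 : y - q ^+ 3 * (q ^- 3 * z^-1) = - (1 - y * z) / z by field; rewrite q0 z0.
rewrite [RHS](_ : _ = ik_num q y (q ^- 3 * z^-1) k (rev_ord j) i (rev_ord l)
   / ((- (1 - q * y * z) / (q * z)) * (- (1 - y * z) / z)) *
   ([:: 1; - (1 - q); - q]`_k / (P * q ^+ 2) ^+ k) * (P * q ^+ 2) ^+ (2 - l)); last first.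
  by rewrite ik_weight_num ?E1 ?E2 // mulf_neq0 ?oppr_eq0 ?invr_eq0 ?mulf_neq0.
rewrite /crossed.
case: i j k l => [[|[|[|i]]] // hi] [[|[|[|j]]] // hj] [[|[|[|k]]] // hk] [[|[|[|l]]] // hl];
  rewrite /= ?mul0r //; field; rewrite ?oppr_eq0 ?mulrA ?q0 ?z0 ?h1 ?h2 ?P0 ?oner_eq0 //.
Qed.

End Weights.

(** * The lattice of the Cauchy identity and its limit *)

Section Rows.
Variables (K : numFieldType) (q : K).

(** The rows of one column: the lines x at the bottom, the crossed lines y at
the top. *)
Definition cauchy_rows (xs ys : seq K) (z : K) : seq (vweight K) :=
  [seq ik_weight q x z | x <- xs] ++ [seq crossed q y z | y <- ys].

(** The 2-string (2^N) as a boundary condition. *)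
Definition twos_top (N : nat) (c : nat) : state := if (c < N)%N then st2 else st0.

(** The states of the right edges far to the right: 0 on [N] lower rows and 2 on
[M] upper rows. *)
Definition ground (N M : nat) : seq state := nseq N st0 ++ nseq M st2.

(** The glued lattice of [L] columns with right boundary [e]. *)
Definition cauchy_grid (xs ys : seq K) (z : nat -> K) (e : seq state) (L : nat) : K :=
  grid (size xs + size ys) (fun k => cauchy_rows xs ys (z k)) (fun=> st0)
    (twos_top (size xs)) (iota 0 L) (nseq (size xs + size ys) st2) e.

(** The bounds on the four kinds of ratios, in one column. *)
Definition contracting (eps : K) (xs ys : seq K) (z : K) :=
  let a1 x := `|ik_weight q x z 0%N 1%N 0%N 1%N| in
  let a2 x := `|ik_weight q x z 0%N 2%N 0%N 2%N| in
  let b1 y := `|crossed q y z 0%N 1%N 0%N 1%N| in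
  let b2 y := `|crossed q y z 0%N 0%N 0%N 0%N| in
  [/\ allrel (fun x y => a1 x * b1 y <= eps) xs ys,
      allrel (fun x y => a2 x * b2 y <= eps) xs ys,
      all (fun x => pairwise (fun y y' => a2 x * (b1 y * b1 y') <= eps) ys) xs
    & all (fun y => pairwise (fun x x' => b2 y * (a1 x * a1 x') <= eps) xs) ys].

Lemma flow_ground N M : flow (ground N M) = (2 * M)%N.
Proof. by rewrite /ground flow_cat !flow_nseq st0E st2E. Qed.

Lemma size_ground N M : size (ground N M) = (N + M)%N.
Proof. by rewrite size_cat !size_nseq. Qed.

Lemma potential_nseq2 M : potential (nseq M st2) = (M * M.+1)%N.
Proof. by elim: M => //= M ->; rewrite size_nseq st2E; nia. Qed.

Lemma potential_ground N M : potential (ground N M) = (M * M.+1)%N.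
Proof.
by rewrite /ground potential_cat flow_nseq potential_nseq0 potential_nseq2 st0E !(muln0, mul0n).
Qed.

Lemma ground_min N M s : flow s = flow (ground N M) -> (potential (ground N M) <= potential s)%N.
Proof.
rewrite flow_ground potential_ground => E; have := potential_min s; rewrite E.
by move: (potential s); clear; nia.
Qed.

Lemma flow_count s :
  flow s = (count (fun a : state => a == 1%N :> nat) s
            + 2 * count (fun a : state => a == 2%N :> nat) s)%N.
Proof.
elim: s => //= a s; rewrite /flow /= => ->.
case: a => [[|[|[|]]] //] /= _; move: (count _ _) (count _ _); clear; lia.
Qed.

Lemma size_count s :
  (count (fun a : state => a == 0%N :> nat) s
   + count (fun a : state => a == 1%N :> nat) s
   + count (fun a : state => a == 2%N :> nat) s = size s)%N.
Proof.
elim: s => //= a s; case: a => [[|[|[|]]] //] /= _;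
  move: (count _ _) (count _ _) (count _ _); clear; lia.
Qed.

Lemma flow_eq0 s : flow s = 0%N -> s = nseq (size s) st0.
Proof.
elim: s => //= a s IH; rewrite /flow /= => E; rewrite -IH; last by move: E; rewrite -/(flow s); lia.
by congr cons; apply/val_inj => /=; rewrite st0E; move: E; clear; lia.
Qed.

Lemma flow_max s : flow s = (2 * size s)%N -> s = nseq (size s) st2.
Proof.
elim: s => //= a s IH; have := flow_le s; rewrite /flow /= -/(flow s) => le E.
have a3 := ltn_ord a; rewrite -IH; last by move: le E a3; clear; rewrite /=; lia.
by congr cons; apply/val_inj => /=; rewrite st2E; move: le E a3; clear; rewrite /=; lia.
Qed.

(** Off the ground state the diagonal entries of the column kernels are at most
[eps]. *)
Lemma contracting_diag (eps : K) xs ys z s : 0 <= eps -> eps <= 1 ->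
  {in ys, forall y, 1 - y * z != 0 /\ 1 - q * y * z != 0} ->
  contracting eps xs ys z ->
  size s = (size xs + size ys)%N -> flow s = (2 * size ys)%N ->
  diagonal (map (@abs_weight K) (cauchy_rows xs ys z)) s
  <= if s == ground (size xs) (size ys) then 1 else eps.
Proof.
move=> e0 e1 np [r1 r2 rx ry] ss fs.
rewrite -[s](cat_take_drop (size xs)).
set s1 := take _ s; set s2 := drop _ s.
have ss1 : size s1 = size xs.
  rewrite size_take ss; case: (size ys) => [|n]; rewrite ?addn0 ?ltnn //.
  by rewrite addnS ltnS leq_addr.
have ss2 : size s2 = size ys by rewrite size_drop ss addKn.
have fs12 : (flow s1 + flow s2 = 2 * size ys)%N by rewrite -flow_cat cat_take_drop.
rewrite /cauchy_rows map_cat diagonal_cat ?size_map //.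
(* The states 0 on the lines x and 2 on the crossed lines have weight 1. *)
rewrite (@diagonal_select _ _ s1 0%N) ?size_map //; last first.
  by elim: (xs) => //= x xs' ?; rewrite /abs_weight /= normr1.
rewrite (@diagonal_select _ _ s2 2%N) ?size_map //; last first.
  elim: (ys) np => //= y ys' IH np; split; last first.
    by apply: IH => y' h; apply: np; rewrite inE h orbT.
  have [h1 h2] := np y (mem_head _ _).
  by rewrite /abs_weight crossed_0202 // normr1.
rewrite -!map_comp.
rewrite /select -!map_mask.
set m1 := [seq a == 1%N :> nat | a : state <- s1].
set m2 := [seq a == (2 - 0)%N :> nat | a : state <- s1].
set n1 := [seq a == 1%N :> nat | a : state <- s2].
set n0 := [seq a == (2 - 2)%N :> nat | a : state <- s2].
have Em1 : size (mask m1 xs) = count (fun a : state => a == 1%N :> nat) s1.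
  by rewrite size_mask ?size_map // count_map.
have Em2 : size (mask m2 xs) = count (fun a : state => a == 2%N :> nat) s1.
  by rewrite size_mask ?size_map // count_map.
have En1 : size (mask n1 ys) = count (fun a : state => a == 1%N :> nat) s2.
  by rewrite size_mask ?size_map // count_map.
have En0 : size (mask n0 ys) = count (fun a : state => a == 0%N :> nat) s2.
  by rewrite size_mask ?size_map // count_map.
have F1 := flow_count s1; have F2 := flow_count s2; have C2 := size_count s2.
apply: le_trans (pairing e0 e1 _ _ _ _ _ _) _.
- rewrite !all_cat; apply/and4P; split; apply/allP => _ /mapP[u _ ->]; exact: normr_ge0.
- rewrite !size_map Em1 Em2 En1 En0; move: fs12 F1 F2 C2; rewrite ss2; clear.
  move: (count _ _) (count _ _) (count _ _) (count _ _) (count _ _); lia.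
- by rewrite allrel_mapl allrel_mapr; apply/allrel_maskl/allrel_maskr/r1.
- by rewrite allrel_mapl allrel_mapr; apply/allrel_maskl/allrel_maskr/r2.
- rewrite all_map; apply/allP => u /mem_mask /(allP rx) /= h.
  by rewrite pairwise_map; apply/pairwise_mask/h.
- rewrite all_map; apply/allP => u /mem_mask /(allP ry) /= h.
  by rewrite pairwise_map; apply/pairwise_mask/h.
rewrite !size_map Em1 Em2; case: ifP => [c0|_]; last by case: ifP.
suff -> : s1 ++ s2 == ground (size xs) (size ys) by [].
have f1 : flow s1 = 0%N.
  by rewrite F1; move: c0; clear; move: (count _ _) (count _ _); lia.
rewrite /ground -ss1 -ss2 -flow_eq0 // -flow_max //.
by move: fs12; rewrite f1 add0n ss2.
Qed.

End Rows.

Lemma every_in (T : Type) (U : eqType) (f : U -> T) (P : T -> Prop) (s : seq U) :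
  {in s, forall x, P (f x)} -> every P (map f s).
Proof.
elim: s => //= x s IH H; split; first by apply: H; rewrite mem_head.
by apply: IH => y ys; apply: H; rewrite inE ys orbT.
Qed.

Section Limit.
Variables (K : numFieldType) (q : K).

(** What the limit needs of the parameters: no poles, bounded weights and
contracting ratios, uniformly in the columns. *)
Definition admissible (B eps : K) (xs ys : seq K) (z : nat -> K) :=
  [/\ forall k, {in xs, forall x, x - q ^+ 2 * z k != 0 /\ x - q ^+ 3 * z k != 0},
      forall k, {in ys, forall y, 1 - y * z k != 0 /\ 1 - q * y * z k != 0},
      forall k, every (bounded_by B) (map (@abs_weight K) (cauchy_rows q xs ys (z k)))
    & forall k, contracting q eps xs ys (z k)].

Lemma admissible_behead B eps xs y ys z :
  admissible B eps xs (y :: ys) z -> admissible B eps xs ys z.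
Proof.
case=> Hx Hy HB Hc; split => [||k|k].
- exact: Hx.
- by move=> k u us; apply: Hy; rewrite inE us orbT.
- have := HB k; rewrite /cauchy_rows !map_cat /= => /every_cat[h1 [_ h2]].
  by apply/every_cat.
- have [r1 r2 rx ry] := Hc k; split.
  + by move: r1; rewrite allrel_consr => /andP[].
  + by move: r2; rewrite allrel_consr => /andP[].
  + by apply/allP => u /(allP rx) /= /andP[].
  + by move: ry => /= /andP[].
Qed.

Lemma abs_cauchy_rows_conserving xs ys z :
  every (@conserving K) (map (@abs_weight K) (cauchy_rows q xs ys z)).
Proof.
rewrite /cauchy_rows map_cat; apply/every_cat; split; rewrite -map_comp;
  apply: every_map => u; apply: abs_weight_conserving.
  exact: ik_weight_conserving.
exact: crossed_conserving.
Qed.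

Lemma size_cauchy_rows xs ys z : size (cauchy_rows q xs ys z) = (size xs + size ys)%N.
Proof. by rewrite size_cat !size_map. Qed.

(** The ground state gives a bound uniform in the number of columns, any other
right boundary a geometrically small one. *)
Lemma abs_bound (B eps eps' : K) xs ys z :
  0 <= B -> 0 <= eps -> eps < eps' -> eps' <= 1 ->
  admissible B eps xs ys z ->
  exists2 D : K, 0 <= D & forall n e, size e = (size xs + size ys)%N ->
    flow e = (2 * size ys)%N ->
    grid (size xs + size ys) (fun k => map (@abs_weight K) (cauchy_rows q xs ys (z k)))
      (fun=> st0) (twos_top (size xs)) (iota 0 (size xs + n))
      (nseq (size xs + size ys) st2) e
    <= D * (if e == ground (size xs) (size ys) then 1 else eps' ^+ n).
Proof.
move=> B0 e0 lte e1 [Hx Hy HB Hc].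
have e1' : eps <= 1 by apply: le_trans (ltW lte) e1.
have := @decay K (size xs + size ys) (fun k => map (@abs_weight K) (cauchy_rows q xs ys (z k)))
  B eps eps' (ground (size xs) (size ys)) _ _ B0 HB e0 lte e1
  (size_ground _ _) _ _ (size xs) (fun=> st0) (twos_top (size xs))
  (nseq (size xs + size ys) st2) _ _.
case.
- by move=> k; rewrite size_map size_cauchy_rows.
- by move=> k; apply: abs_cauchy_rows_conserving.
- by move=> s _; apply: ground_min.
- move=> k s ss; rewrite flow_ground => fs.
  by apply: contracting_diag => // y /Hy; apply.
- by rewrite size_nseq.
- by move=> k lek; rewrite /twos_top ltnNge lek.
by move=> D D0 H; exists D => // n e se fe; apply: H; rewrite // flow_ground.
Qed.

Lemma foldr_prod (xs : seq K) (f : K -> vweight K) (i j k l : nat) :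
  foldr (fun (r : vweight K) p => p * r i j k l) 1 (map f xs)
  = \prod_(x <- xs) f x i j k l.
Proof.
elim: xs => [|x xs IH] /=; first by rewrite big_nil.
by rewrite big_cons IH mulrC.
Qed.

(** The lowest crossed line y, moved below the lines x, leaves the lattice. *)
Lemma exchange_step xs y ys z L :
  (forall k, {in xs, forall x, x - q ^+ 2 * z k != 0 /\ x - q ^+ 3 * z k != 0}) ->
  (forall k, 1 - y * z k != 0 /\ 1 - q * y * z k != 0) ->
  let rs := [seq ik_num q 1 (x * y) | x <- xs] in
  let N := size xs in let M := size ys in
  (\prod_(x <- xs) ((1 - q ^+ 2 * (x * y)) * (1 - q ^+ 3 * (x * y))))
    * cauchy_grid q xs ys z (ground N M) L
  = (\prod_(x <- xs) ((1 - x * y) * (1 - q * (x * y))))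
    * cauchy_grid q xs (y :: ys) z (ground N M.+1) L
  + \sum_(e : (N + M).+1.-tuple state | e != ground N M.+1 :> seq _)
      cauchy_grid q xs (y :: ys) z e L * cross rs e (st2 :: ground N M).
Proof.
move=> Hx Hy rs N M.
have Hrs : every (@conserving K) rs.
  by apply: every_map => x; apply: ik_num_conserving.
pose pk k := [seq (ik_num q 1 (x * y), ik_weight q x (z k)) | x <- xs].
have pk1 k : map fst (pk k) = rs by rewrite -map_comp.
have pk2 k : map snd (pk k) = [seq ik_weight q x (z k) | x <- xs] by rewrite -map_comp.
have H1 k : map fst (pk k) = map fst (pk 0%N) by rewrite !pk1.
have H2 k : every (fun p => yang_baxter p.1 (crossed q y (z k)) p.2) (pk k).
  apply: every_in => x xs' /=; have [h1 h2] := Hx k x xs'.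
  exact: weights_yang_baxter.
have H3 k : (size (pk 0%N) + size [seq crossed q u (z k) | u <- ys]).+1 = (N + M).+1.
  by rewrite !size_map.
have H4 : size (nseq (N + M).+1 st2) = (N + M).+1 by rewrite size_nseq.
have H5 : size (st2 :: ground N M) = (N + M).+1 by rewrite /= size_ground.
have := cross_grid (fun=> st0) (twos_top N) (iota 0 L) H1 H2 H3 H4 H5.
rewrite pk1.
have sE : nseq (N + M).+1 st2 = nseq (size rs) st2 ++ st2 :: nseq M st2.
  by rewrite -[st2 :: nseq M st2]/(nseq M.+1 st2) -nseqD size_map addnS.
(* On the left-hand side the row y is the lowest one and drops out. *)
have gB : grid (N + M).+1
    (fun k => crossed q y (z k) :: map snd (pk k) ++ [seq crossed q u (z k) | u <- ys])
    (fun=> st0) (twos_top N) (iota 0 L) (nseq (N + M).+1 st2) (st2 :: ground N M)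
  = cauchy_grid q xs ys z (ground N M) L.
  rewrite /= grid_frozen ?eqxx ?mul1r.
    by apply: eq_grid => k _; rewrite pk2.
  move=> k _; have [h1 h2] := Hy k; split => //; first exact: crossed_conserving.
  exact: crossed_0202.
have gA e : grid (N + M).+1
    (fun k => map snd (pk k) ++ crossed q y (z k) :: [seq crossed q u (z k) | u <- ys])
    (fun=> st0) (twos_top N) (iota 0 L) (nseq (N + M).+1 st2) e
  = cauchy_grid q xs (y :: ys) z e L.
  by rewrite /cauchy_grid /= addnS; apply: eq_grid => k _; rewrite pk2.
under [LHS]eq_bigr => u _ do rewrite {1}sE cross_frozen // -sE -mulrA eq_sym.
rewrite -mulr_sumr (big_tuple_delta (fun u => grid (N + M).+1
    (fun k => crossed q y (z k) :: map snd (pk k) ++ [seq crossed q u (z k) | u <- ys])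
    (fun=> st0) (twos_top N) (iota 0 L) u (st2 :: ground N M)) H4) gB.
under [RHS]eq_bigr => u _ do rewrite gA.
have sg : size (ground N M.+1) == (N + M).+1 by rewrite size_ground addnS.
rewrite (bigD1 (Tuple sg)) //=.
have -> : cross rs (ground N M.+1) (st2 :: ground N M)
  = \prod_(x <- xs) ((1 - x * y) * (1 - q * (x * y))).
  have := @cross_unchanged K rs (nseq M st2) Hrs.
  by rewrite size_map => ->; rewrite foldr_prod.
rewrite foldr_prod => ->; rewrite [cauchy_grid _ _ _ _ _ _ * _]mulrC.
by congr (_ + _).
Qed.

Lemma cauchy_grid_bound (B eps eps' : K) xs ys z :
  0 <= B -> 0 <= eps -> eps < eps' -> eps' <= 1 ->
  admissible B eps xs ys z ->
  exists2 D : K, 0 <= D & forall n e, size e = (size xs + size ys)%N ->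
    flow e = (2 * size ys)%N -> e != ground (size xs) (size ys) ->
    `|cauchy_grid q xs ys z e (size xs + n)| <= D * eps' ^+ n.
Proof.
move=> B0 e0 lte e1 H; have [D D0 HD] := abs_bound B0 e0 lte e1 H.
exists D => // n e se fe ne; apply: le_trans (norm_grid _ _ _ _ _ _ _) _.
by have := HD n e se fe; rewrite (negPf ne).
Qed.

(** The factor contributed by a line x and a crossed line y. *)
Definition cauchy_factor (x y : K) :=
  ((1 - q ^+ 2 * (x * y)) * (1 - q ^+ 3 * (x * y)))
  / ((1 - x * y) * (1 - q * (x * y))).

(** For [ys] empty the lattice is that of F with top boundary (2^N); each crossed
line then contributes its factors. *)
Lemma cauchy_grid_limit (B eps eps' : K) xs ys z :
  0 <= B -> 0 <= eps -> eps < eps' -> eps' <= 1 ->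
  admissible B eps xs ys z ->
  {in xs & ys, forall x y, 1 - x * y != 0 /\ 1 - q * (x * y) != 0} ->
  exists2 D : K, 0 <= D & forall n,
    `|cauchy_grid q xs ys z (ground (size xs) (size ys)) (size xs + n)
      - cauchy_grid q xs [::] z (ground (size xs) 0) (size xs)
        * \prod_(y <- ys) \prod_(x <- xs) cauchy_factor x y| <= D * eps' ^+ n.
Proof.
move=> B0 e0 lte e1; have e'0 : 0 <= eps' by apply: le_trans e0 (ltW lte).
elim: ys => [|y ys IH] H np.
  exists 0 => // n; rewrite big_nil mulr1 mul0r.
  (* Without crossed lines the columns after the first [size xs] are empty. *)
  suff -> : cauchy_grid q xs [::] z (ground (size xs) 0) (size xs + n)
    = cauchy_grid q xs [::] z (ground (size xs) 0) (size xs) by rewrite subrr normr0.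
  have gE : ground (size xs) 0 = nseq (size xs + size ([::] : seq K)) st0.
    by rewrite /ground cats0 addn0.
  rewrite /cauchy_grid gE (grid_pad (leq_addr n _)) ?size_nseq // => k lek.
  split => //; first by rewrite /twos_top ltnNge lek.
    by rewrite size_cauchy_rows.
  rewrite /cauchy_rows cats0; apply: every_map => x; split => //.
  exact: ik_weight_conserving.
have [] := IH (admissible_behead H).
  by move=> x u xs' us; apply: np; rewrite // inE us orbT.
move=> D D0 HD; have [D1 D10 HD1] := cauchy_grid_bound B0 e0 lte e1 H.
pose rs := [seq ik_num q 1 (x * y) | x <- xs].
have Hrs : every (@conserving K) rs by apply: every_map => x; apply: ik_num_conserving.
pose d := \prod_(x <- xs) ((1 - x * y) * (1 - q * (x * y))).
pose p := \prod_(x <- xs) ((1 - q ^+ 2 * (x * y)) * (1 - q ^+ 3 * (x * y))).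
have d0 : d != 0.
  rewrite /d prodf_seq_neq0; apply/allP => x xs' /=.
  by have [h1 h2] := np x y xs' (mem_head _ _); rewrite mulf_neq0.
have fE : \prod_(x <- xs) cauchy_factor x y = p / d.
  by rewrite /cauchy_factor big_split /= prodfV.
pose T := (size xs + size ys).+1.-tuple state.
pose C := \sum_(e : T) `|cross rs e (st2 :: ground (size xs) (size ys))|.
have C0 : 0 <= C by apply: sumr_ge0.
exists (`|p / d| * D + `|d|^-1 * (D1 * C)).
  by rewrite addr_ge0 ?mulr_ge0 ?invr_ge0.
move=> n; have [Hx Hy _ _] := H.
have := @exchange_step xs y ys z (size xs + n) Hx (fun k => Hy k y (mem_head _ _)).
rewrite /= -/rs -/d -/p; set err := (\sum_(e | _) _) => E.
set Z' := cauchy_grid q xs (y :: ys) z _ _ in E *.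
set Z := cauchy_grid q xs ys z _ _ in E HD.
have -> : Z' = p / d * Z - d^-1 * err.
  by rewrite mulrAC E; field.
rewrite big_cons fE; set F0 := cauchy_grid _ _ _ _ _ _; set Pi := \prod_(j <- ys) _.
have -> : p / d * Z - d^-1 * err - F0 * (p / d * Pi)
  = p / d * (Z - F0 * Pi) - d^-1 * err by field.
apply: le_trans (ler_normB _ _) _; rewrite mulrDl; apply: lerD.
  by rewrite normrM -mulrA ler_wpM2l // HD.
rewrite normrM normfV -mulrA ler_wpM2l ?invr_ge0 //.
apply: le_trans (ler_norm_sum _ _ _) _.
rewrite -mulrA [C * _]mulrC mulrA /C mulr_sumr.
apply: (@le_trans _ _ (\sum_(e : T | e != ground (size xs) (size ys).+1 :> seq _)
   D1 * eps' ^+ n * `|cross rs e (st2 :: ground (size xs) (size ys))|)).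
  apply: ler_sum => e eg; rewrite normrM.
  have [->|nz] := eqVneq (cross rs e (st2 :: ground (size xs) (size ys))) 0.
    by rewrite normr0 !mulr0.
  apply: ler_wpM2r => //; apply: HD1 => //; first by rewrite size_tuple addnS.
  rewrite (cross_conserve Hrs nz) /flow /= -/(flow _) flow_ground st2E; clear; lia.
rewrite [leRHS](bigID (fun e : T => e != ground (size xs) (size ys).+1 :> seq _)) /=.
rewrite lerDl; apply: sumr_ge0 => e _; rewrite !mulr_ge0 ?exprn_ge0 //.
Qed.

End Limit.

(** * The functions F and G as lattices of any width *)

Lemma ord0_st0 : ord0 = st0 :> state.
Proof. by apply/val_inj; rewrite /= st0E. Qed.

Section Strings.

Lemma mem_supp_bound (S : string2) k : k \in finsupp S -> (k < supp_bound S)%N.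
Proof.
move=> kS; rewrite /supp_bound.
exact: (@leq_bigmax_seq _ _ xpredT (fun k => k.+1) k).
Qed.

Lemma supp_bound_out (S : string2) k : (supp_bound S <= k)%N -> S k = st0.
Proof.
move=> le; rewrite fsfun_dflt ?ord0_st0 //; apply/negP => /mem_supp_bound.
by rewrite ltnNge le.
Qed.

Lemma big_finsupp (R : Type) (idx : R) (op : Monoid.com_law idx) (S : string2) L
    (F : nat -> R) : (supp_bound S <= L)%N ->
  (forall k, k \notin finsupp S -> F k = idx) ->
  \big[op/idx]_(k <- finsupp S) F k = \big[op/idx]_(k <- iota 0 L) F k.
Proof.
move=> leL Fout; rewrite [RHS](bigID (mem (finsupp S))) /=.
rewrite [X in op _ X]big1 ?Monoid.mulm1; last by move=> k; apply: Fout.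
rewrite -[RHS]big_filter; apply: perm_big; apply: uniq_perm.
- exact: fset_uniq.
- by rewrite filter_uniq ?iota_uniq.
move=> k; rewrite mem_filter mem_iota add0n /=.
by case: (boolP (k \in finsupp S)) => //= /mem_supp_bound h; rewrite (leq_trans h).
Qed.

Lemma supp_boundP (S : string2) L :
  (forall k, (L <= k)%N -> S k = st0) -> (supp_bound S <= L)%N.
Proof.
move=> H; apply/bigmax_leqP_seq => k kS _; rewrite ltnNge; apply/negP => /H E.
by move: kS; rewrite mem_finsupp E ord0_st0 eqxx.
Qed.

Lemma twosE N k : twos N k = twos_top N k.
Proof.
rewrite /twos fsfunE /twos_top ord0_st0 in_fset /=.
by rewrite mem_iota add0n.
Qed.

End Strings.

Section Bridge.
Variables (K : fieldType) (q : K).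

Lemma lattice_sum_grid m L (u : 'I_m -> K) (z : nat -> K) (a b : state) bot top :
  lattice_sum q L u z a b bot top
  = grid m (fun k => [seq ik_weight q (u i) (z k) | i <- enum 'I_m])
      bot top (iota 0 L) (nseq m a) (nseq m b).
Proof.
have := lattice_grid L (fun i k => ik_weight q (u i) (z k)) [tuple of nseq m a]
  [tuple of nseq m b] bot top 0.
move=> <-; apply: eq_bigl => h; apply: eq_forallb => r.
by rewrite !(tnth_nth st0) /= !nth_nseq ltn_ord.
Qed.

Lemma vacuum_weights m (u : 'I_m -> K) z : 
  every (@vacuum_one K) [seq ik_weight q (u i) z | i <- enum 'I_m].
Proof. by apply: every_map => i; split => //; exact: ik_weight_conserving. Qed.

Lemma F_grid N (x : 'I_N -> K) z S L : (supp_bound S <= L)%N ->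
  F q x z S = grid N (fun k => [seq ik_weight q (x i) (z k) | i <- enum 'I_N])
    (fun=> st0) S (iota 0 L) (nseq N st2) (nseq N st0).
Proof.
move=> leL; rewrite /F lattice_sum_grid -(grid_pad leL) ?size_nseq // => k lek.
split => //; first exact: supp_bound_out.
- by rewrite size_map size_enum_ord.
- exact: vacuum_weights.
Qed.

Lemma G_grid N M (y : 'I_M -> K) z S L : (supp_bound S <= L)%N -> (N <= L)%N ->
  G q N y z S = grid M (fun k => [seq ik_weight q (y i) (z k) | i <- enum 'I_M])
    (twos_top N) S (iota 0 L) (nseq M st0) (nseq M st0).
Proof.
move=> leL leN; rewrite /G lattice_sum_grid.
have le : (maxn N (supp_bound S) <= L)%N by rewrite geq_max leN.
rewrite -(grid_pad le) ?size_nseq // => k; rewrite geq_max => /andP[leNk lek].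
split => //.
- by rewrite ltnNge leNk.
- exact: supp_bound_out.
- by rewrite size_map size_enum_ord.
- exact: vacuum_weights.
Qed.

Lemma gauge_st0 c : gauge q c st0 = 1.
Proof. by rewrite /gauge st0E /= expr0 divr1. Qed.

(** Up to sign, c_S is the inverse of the gauge factor of the boundary S. *)
Lemma cS_gauge (S : string2) N : q != 0 -> q != 1 -> size2 S = (2 * N)%N ->
  cS q S * \prod_(k <- finsupp S) gauge q k (S k) = (-1) ^+ N.
Proof.
move=> q0 q1; rewrite /size2 /cS /mult2.
have q1' : 1 - q != 0 by rewrite subr_eq0 eq_sym.
set ks := finsupp S : seq nat.
have E1 (l : seq nat) : (\sum_(k <- l) S k = count (fun k => S k == 1%N :> nat) l
    + 2 * count (fun k => S k == 2%N :> nat) l)%N.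
  elim: l => [|k l IH]; first by rewrite big_nil.
  rewrite big_cons IH /=; case: (S k) => [[|[|[|]]] //] /= _;
    move: (count _ _) (count _ _); clear; lia.
have E2 (l : seq nat) : (1 - q) ^- count (fun k => S k == 1%N :> nat) l
    * q ^- count (fun k => S k == 2%N :> nat) l
    * (\prod_(k <- l) q ^+ (2 * k.+1 * S k)) * \prod_(k <- l) gauge q k (S k)
  = (-1) ^+ (count (fun k => S k == 1%N :> nat) l + count (fun k => S k == 2%N :> nat) l).
  elim: l => [|k l IH]; first by rewrite !big_nil /= !expr0 invr1 !mulr1.
  rewrite !big_cons /=.
  set c1 := count _ l in IH *; set c2 := count _ l in IH *.
  set p1 := \prod_(j <- l) _ in IH *; set p2 := \prod_(j <- l) _ in IH *.
  have h1 : (1 - q) ^+ c1 != 0 by rewrite expf_neq0.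
  have h2 : q ^+ c2 != 0 by rewrite expf_neq0.
  rewrite /gauge exprM; set Q := q ^+ (2 * k.+1).
  have Q0 : Q != 0 by rewrite expf_neq0.
  case: (S k) => [[|[|[|]]] //] /= _; rewrite ?add0n ?add1n ?addSn ?addnS ?add0n.
  - rewrite -IH; move: h1 h2; clear.
    by move: (_ ^+ c1) (_ ^+ c2) p1 p2 => a b p1 p2 a0 b0; field; rewrite a0 b0 oner_eq0.
  - rewrite !exprS expr0 mulr1 -IH; move: h1 h2 q1' Q0; clear.
    move: (_ ^+ c1) (_ ^+ c2) p1 p2 Q => a b p1 p2 Q a0 b0 q1' Q0.
    by field; rewrite a0 b0 q1' Q0.
  - rewrite !exprS expr0 mulr1 -IH; move: h1 h2 q0 Q0; clear.
    move: (_ ^+ c1) (_ ^+ c2) p1 p2 Q => a b p1 p2 Q a0 b0 q0 Q0.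
    by field; rewrite a0 b0 q0 Q0.
rewrite E1 => Es; have := E2 ks.
set c1 := count _ _ in Es *; set c2 := count _ _ in Es *.
rewrite -!mulrA => ->; rewrite -exprD.
(* Both exponents have the parity of N, since c_1 = 2 (N - c_2). *)
rewrite -[LHS]signr_odd -[RHS]signr_odd; congr (_ ^+ nat_of_bool _).
have -> : c1 = (N - c2).*2 by move: Es; clear; lia.
rewrite doubleK !oddD odd_double /= -oddD subnK //; move: Es; clear; lia.
Qed.

Lemma gauge_twos N : q != 0 ->
  \prod_(k <- iota 0 N) gauge q k (twos_top N k) = (-1) ^+ N * q ^- (N * (2 * N + 1)).
Proof.
move=> q0.
transitivity (\prod_(k <- iota 0 N) (- q / (q ^+ (2 * k.+1)) ^+ 2)).
  rewrite big_seq [RHS]big_seq; apply: eq_bigr => k.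
  by rewrite mem_iota add0n /= /twos_top => ->; rewrite /gauge st2E.
elim: N => [|n IH]; first by rewrite big_nil expr0 mul1r mul0n expr0 invr1.
rewrite -{1}addn1 iotaD big_cat /= big_seq1 IH add0n -exprM [(-1) ^+ n.+1]exprS.
have -> : (n.+1 * (2 * n.+1 + 1) = n * (2 * n + 1) + (4 * n + 3))%N by clear; nia.
have -> : (2 * n.+1 * 2 = (4 * n + 3) + 1)%N by clear; lia.
rewrite !exprD expr1; set u := q ^+ (_ * _); set v := q ^+ n; set w := q ^+ 3.
have u0 : u != 0 by rewrite expf_neq0.
have v0 : v != 0 by rewrite expf_neq0.
have w0 : w != 0 by rewrite expf_neq0.
by field; rewrite u0 v0 w0 q0.
Qed.

(** c_S G_S is a power of q times the partition function of the lattice of crossed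
lines. *)
Lemma cS_G N M (y : 'I_M -> K) z (S : string2) L :
  q != 0 -> q != 1 -> (forall k, z k != 0) ->
  (forall j k, 1 - y j * z k != 0 /\ 1 - q * y j * z k != 0) ->
  size2 S = (2 * N)%N -> (supp_bound S <= L)%N -> (N <= L)%N ->
  cS q S * G q N y (fun k => q ^- 3 * (z k)^-1) S
  = q ^+ (N * (2 * N + 1))
    * grid M (fun k => [seq crossed q (y j) (z k) | j <- rev (enum 'I_M)])
        S (twos_top N) (iota 0 L) (nseq M st2) (nseq M st2).
Proof.
move=> q0 q1 z0 np sS leL leN.
pose pw c := [seq (crossed q (y j) (z c), ik_weight q (y j) (q ^- 3 * (z c)^-1))
   | j <- rev (enum 'I_M)].
have H1 c : every (fun p : vweight K * vweight K => forall i j k l : state,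
    p.1 i j k l * gauge q c i * hgauge q c j
    = p.2 k (rev_ord j) i (rev_ord l) * gauge q c k * hgauge q c.+1 l) (pw c).
  apply: every_map => j i j' k l /=; have [h1 h2] := np j c.
  exact: crossed_symmetry.
have H2 c : size (pw c) = M by rewrite size_map size_rev size_enum_ord.
have H3 : size (nseq M st2) = M by rewrite size_nseq.
have := grid_flip S (twos_top N) 0 L H1 H2 H3 H3.
have -> : rev (map (@rev_ord 3) (nseq M st2)) = nseq M st0.
  rewrite map_nseq rev_nseq; congr nseq.
  by apply/val_inj; rewrite /= st2E st0E.
have hg c : \prod_(a <- nseq M st2) hgauge q c a = 1.
  rewrite big_seq big1 // => a /nseqP[-> _]; by rewrite /hgauge st2E subnn expr0.
rewrite !hg !mulr1.
have e1 : grid M (fun c => map fst (pw c)) S (twos_top N) (iota 0 L) (nseq M st2) (nseq M st2)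
  = grid M (fun k => [seq crossed q (y j) (z k) | j <- rev (enum 'I_M)])
        S (twos_top N) (iota 0 L) (nseq M st2) (nseq M st2).
  by apply: eq_grid => k _; rewrite -map_comp.
have e2 : grid M (fun c => rev (map snd (pw c))) (twos_top N) S (iota 0 L) (nseq M st0) (nseq M st0)
  = G q N y (fun k => q ^- 3 * (z k)^-1) S.
  by rewrite (G_grid _ _ leL leN); apply: eq_grid => k _; rewrite -map_comp map_rev revK.
rewrite e1 e2 => E.
have gS : \prod_(c <- iota 0 L) gauge q c (S c) = \prod_(c <- finsupp S) gauge q c (S c).
  by apply/esym/big_finsupp => // k kS; rewrite fsfun_dflt // ord0_st0 gauge_st0.
have gN : \prod_(c <- iota 0 L) gauge q c (twos_top N c) = (-1) ^+ N * q ^- (N * (2 * N + 1)).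
  rewrite -gauge_twos // -(subnKC leN) iotaD big_cat add0n /= [X in _ * X]big_seq.
  rewrite [X in _ * X]big1 ?mulr1 // => k; rewrite mem_iota => /andP[leNk _].
  by rewrite /twos_top ltnNge leNk gauge_st0.
have cg := cS_gauge q0 q1 sS; move: E; rewrite gS gN.
set g := \prod_(c <- _) _ in cg *; set Gs := grid _ _ _ _ _ _ _.
set Gq := G _ _ _ _ _; set c := cS _ _ in cg *; set p := q ^+ _.
have p0 : p != 0 by rewrite expf_neq0.
have s0 : (-1) ^+ N != 0 :> K by rewrite signr_eq0.
have g0 : g != 0 by apply: contraNneq s0 => g0; rewrite -cg g0 mulr0.
move=> E; have -> : Gq = Gs * g / ((-1) ^+ N / p) by rewrite E mulfK // mulf_neq0 ?invr_eq0.
by rewrite -cg; field; rewrite p0 g0 /=; apply: contraNneq s0 => c0; rewrite -cg c0 mul0r.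
Qed.

End Bridge.

(** * Unconditional sums along an exhaustion *)

Lemma cvg_partial_sum (K : numFieldType) (I : choiceType) (f : I -> K) (s : K) :
  (forall e : K, 0 < e -> exists B : {fset I}, forall D : {fset I},
     (B `<=` D)%fset -> `|s - partial_sum f D| <= e) ->
  (partial_sum f @ totally --> s)%classic.
Proof.
move=> H; have FF : Filter (@totally I) by apply: totally_filter.
apply/cvgrPdist_le => e /H[B HB]; exists B => // D; exact: HB.
Qed.

Section HasSum.
Variable R : realType.

Lemma complex_norm_real (c : R[i]) : `|c| = (complex.Re `|c|)%:C.
Proof. by have /complex_realP[r ->] := normr_real c. Qed.

(** An unconditional sum exists as soon as the norms have bounded sums and the
sums along one exhaustion converge: a finite set whose sum of norms is within
e/2 of the supremum controls all larger finite sets. *)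
Lemma has_sum_exhaust (I : choiceType) (f : I -> R[i]) (s : R[i])
    (A : nat -> {fset I}) (C : R[i]) :
  (forall n m, (n <= m)%N -> A n `<=` A m)%fset ->
  (forall i, exists n, i \in A n) ->
  (forall n, \sum_(i <- A n) `|f i| <= C) ->
  (forall e : R, 0 < e -> exists n0, forall n, (n0 <= n)%N ->
     `|\sum_(i <- A n) f i - s| <= e%:C) ->
  has_sum f s.
Proof.
move=> Amono Aex AC lim.
pose g i : R := complex.Re `|f i|.
have gE i : `|f i| = (g i)%:C by rewrite complex_norm_real.
have g0 i : 0 <= g i by have := normr_ge0 (f i); rewrite gE lecR.
have Acov (B : {fset I}) n0 : exists2 n, (n0 <= n)%N & (B `<=` A n)%fset.
  elim/finSet_rect: B => B IH.
  have [->|[i iB]] := fset_0Vmem B; first by exists n0; rewrite ?fsub0set.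
  have [n le sub] := IH _ (fproperD1 iB); have [m im] := Aex i.
  exists (maxn n m); first by rewrite leq_max le.
  apply/fsubsetP => j jB; have [->|ji] := eqVneq j i.
    by apply: (fsubsetP (Amono m _ _)); rewrite ?leq_maxr.
  apply: (fsubsetP (Amono n _ _)); rewrite ?leq_maxl //.
  by apply: (fsubsetP sub); rewrite !inE ji.
have sub_split (V : zmodType) (h : I -> V) (B D : {fset I}) : (B `<=` D)%fset ->
    \sum_(i <- D) h i = \sum_(i <- B) h i + \sum_(i <- (D `\` B)%fset) h i.
  move=> BD; rewrite (bigID (mem B)) /=; congr (_ + _).
    rewrite -big_filter; apply: perm_big; apply: uniq_perm; rewrite ?filter_uniq //.
    move=> i; rewrite mem_filter /=; apply: andb_idr; exact: (fsubsetP BD).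
  rewrite -big_filter; apply: perm_big; apply: uniq_perm; rewrite ?filter_uniq //.
  by move=> i; rewrite mem_filter inE.
have gC (B : {fset I}) : \sum_(i <- B) g i <= complex.Re C.
  have [n _ sub] := Acov B 0%N.
  apply: (@le_trans _ _ (\sum_(i <- A n) g i)).
    rewrite (sub_split _ _ _ _ sub) lerDl; exact: sumr_ge0.
  have := AC n; under eq_bigr do rewrite gE.
  rewrite -raddf_sum; case: C {AC} => a b /=; rewrite lecE /= => /andP[_]; exact.
pose U : set R := [set r | exists B : {fset I}, r = \sum_(i <- B) g i]%classic.
have supU : has_sup U.
  split; first by exists (\sum_(i <- fset0) g i), fset0.
  by exists (complex.Re C) => _ [B ->]; exact: gC.
apply: (@cvg_partial_sum (R[i] : numFieldType)) => e0 e0pos.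
have [e e00 eE] : exists2 e : R, 0 < e & e0 = e%:C.
  have /complex_realP[e eE] : e0 \is Num.real by rewrite realE ltW.
  by exists e => //; rewrite -ltcR -eE.
have e20 : 0 < e / 2 by rewrite divr_gt0.
have [_ [B ->] HB] := sup_adherent e20 supU.
have [n0 Hn0] := lim _ e20.
exists B => // D /= BD.
(* D is compared with a member of the exhaustion that contains it. *)
have [n len sub] := Acov D n0.
have -> : partial_sum f D = \sum_(i <- D) f i by rewrite [RHS]big_seq_fsetE.
have -> : s - \sum_(i <- D) f i
  = \sum_(i <- (A n `\` D)%fset) f i - (\sum_(i <- A n) f i - s).
  by rewrite (sub_split _ f _ _ sub) opprB addrCA; ring.
apply: le_trans (ler_normB _ _) _.
have -> : e0 = (e / 2)%:C + (e / 2)%:C by rewrite eE -raddfD /= -splitr.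
apply: lerD; last exact: Hn0.
apply: le_trans (ler_norm_sum _ _ _) _.
under eq_bigr do rewrite gE.
rewrite -raddf_sum lecR.
have h1 : \sum_(i <- A n) g i <= sup U.
  by apply: ub_le_sup; [case: supU | exists (A n)].
have h2 := sub_split _ g _ _ sub.
have h3 : \sum_(i <- B) g i <= \sum_(i <- D) g i.
  by rewrite (sub_split _ g _ _ BD) lerDl; apply: sumr_ge0.
lra.
Qed.

Lemma geometric_small (D r e : R) : 0 <= r -> r < 1 -> 0 < e ->
  exists n0, forall n, (n0 <= n)%N -> D * r ^+ n <= e.
Proof.

move=> r0 r1 e0.
have : ((fun n => D * r ^+ n) @ \oo --> D * 0)%classic.
  by apply: cvgMr; apply: cvg_expr; rewrite ger0_norm.
rewrite mulr0.
move/cvgrPdist_le => /(_ e e0)[n0 _ H]; exists n0 => n len.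
have := H n len; rewrite sub0r normrN; apply: le_trans; exact: ler_norm.
Qed.

End HasSum.

(** * 2-strings supported in the first L columns *)

(** The 2-string with given first entries, followed by zeros. *)
Definition string_of (t : seq state) : string2 :=
  [fsfun k in [fset k | k in iota 0 (size t)]%fset => nth st0 t k | ord0].

Lemma string_ofE t k : string_of t k = nth st0 t k.
Proof.
rewrite /string_of fsfunE in_fset /= mem_iota add0n /=.
by case: ltnP => // h; rewrite nth_default // ord0_st0.
Qed.

Lemma supp_string_of t : (supp_bound (string_of t) <= size t)%N.
Proof. by apply: supp_boundP => k h; rewrite string_ofE nth_default. Qed.

Lemma string_of_inj L : injective (fun t : L.-tuple state => string_of t).
Proof.
move=> t u E; apply: eq_from_tnth => i; rewrite !(tnth_nth st0).
by rewrite -!string_ofE E.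
Qed.

Lemma string_of_tuple (S : string2) L : (supp_bound S <= L)%N ->
  exists t : L.-tuple state, S = string_of t.
Proof.
move=> le; exists [tuple S i | i < L]; apply/fsfunP => k; rewrite string_ofE.
have [h|h] := ltnP k L.
  by rewrite -[k]/(val (Ordinal h)) -tnth_nth tnth_mktuple.
by rewrite nth_default ?size_tuple // supp_bound_out // (leq_trans le).
Qed.

(** The 2-strings of size [n] supported in the first [L] columns. *)
Definition strings_below (n L : nat) : {fset strings_of_size n} :=
  [fset S in (pmap insub [seq string_of t | t : L.-tuple state]
              : seq (strings_of_size n))]%fset.

Lemma mem_strings_below n L (S : strings_of_size n) :
  (S \in strings_below n L) = (supp_bound (val S) <= L)%N.
Proof.
rewrite in_fset mem_pmap_sub; apply/mapP/idP => [[t _ ->]|/string_of_tuple[t ->]].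
  by rewrite (leq_trans (supp_string_of t)) ?size_tuple.
by exists t; rewrite ?mem_enum.
Qed.

Lemma sum_strings_below (V : nmodType) n L (h : string2 -> V) :
  \sum_(S <- strings_below n L) h (val S)
  = \sum_(t : L.-tuple state | size2 (string_of t) == n) h (string_of t).
Proof.
have H (l : seq string2) : \sum_(S <- (pmap insub l : seq (strings_of_size n))) h (val S)
    = \sum_(S <- l | size2 S == n) h S.
  elim: l => [|S l IH]; first by rewrite !big_nil.
  rewrite big_cons /= -IH; case: insubP => [u -> <-|/negPf->] //=.
  by rewrite big_cons.
transitivity (\sum_(t <- enum {: L.-tuple state} | size2 (string_of t) == n)
    h (string_of t)); last by rewrite big_enum_cond; apply: eq_bigl => t; rewrite inE.
rewrite -(big_map (fun t : L.-tuple state => string_of t)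
  (fun S => size2 S == n) h) -H; apply: perm_big; apply: uniq_perm.
- exact: fset_uniq.
- by rewrite pmap_sub_uniq // map_inj_uniq ?enum_uniq //; exact: string_of_inj.
by move=> S; rewrite in_fset.
Qed.

(** * Uniform bounds on the weights *)

Section Bound.
Variable K : numFieldType.

(** The coefficients of a quadratic form, read off its values at (1, 0), (1, 1) and
(0, 1). *)
Lemma ik_num_quadratic (q x y : K) (i j k l : state) :
  ik_num q x y i j k l
  = ik_num q 1 0 i j k l * x ^+ 2
    + (ik_num q 1 1 i j k l - ik_num q 1 0 i j k l - ik_num q 0 1 i j k l) * (x * y)
    + ik_num q 0 1 i j k l * y ^+ 2.
Proof.
case: i j k l => [[|[|[|i]]] // hi] [[|[|[|j]]] // hj] [[|[|[|k]]] // hk] [[|[|[|l]]] // hl];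
  rewrite /=; ring.
Qed.

Lemma ik_num_bound (q : K) : exists2 C : K, 0 <= C &
  forall x y (i j k l : state), `|ik_num q x y i j k l| <= C * (`|x| + `|y|) ^+ 2.
Proof.
pose c (p : state * state * state * state) :=
  `|ik_num q 1 0 p.1.1.1 p.1.1.2 p.1.2 p.2|
  + `|ik_num q 1 1 p.1.1.1 p.1.1.2 p.1.2 p.2 - ik_num q 1 0 p.1.1.1 p.1.1.2 p.1.2 p.2
     - ik_num q 0 1 p.1.1.1 p.1.1.2 p.1.2 p.2|
  + `|ik_num q 0 1 p.1.1.1 p.1.1.2 p.1.2 p.2|.
have c0 p : 0 <= c p by rewrite !addr_ge0.
exists (\sum_p c p); first exact: sumr_ge0.
move=> x y i j k l.
apply: (@le_trans _ _ (c (i, j, k, l) * (`|x| + `|y|) ^+ 2)); last first.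
  apply: ler_wpM2r; first by rewrite exprn_ge0 // addr_ge0.
  by rewrite (bigD1 (i, j, k, l)) //= lerDl; apply: sumr_ge0.
rewrite ik_num_quadratic /c /= [leRHS]mulrDl [X in _ <= X + _]mulrDl.
have X0 := normr_ge0 x; have Y0 := normr_ge0 y.
have XY := mulr_ge0 X0 Y0.
have XX := mulr_ge0 X0 X0; have YY := mulr_ge0 Y0 Y0.
have E : (`|x| + `|y|) ^+ 2 = `|x| * `|x| + (`|x| * `|y|) *+ 2 + `|y| * `|y|.
  by rewrite sqrrD !expr2.
apply: le_trans (ler_normD _ _) _; apply: lerD.
  apply: le_trans (ler_normD _ _) _; apply: lerD; rewrite normrM; apply: ler_wpM2l => //.
    by rewrite normrX expr2 E -addrA lerDl addr_ge0 // mulrn_wge0.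
  by rewrite normrM E mulr2n -!addrA [leRHS]addrCA lerDl !addr_ge0.
rewrite normrM; apply: ler_wpM2l => //.
by rewrite normrX expr2 E lerDr addr_ge0 // mulrn_wge0.
Qed.

Lemma ratio_bound (C d X n d1 d2 : K) : 0 <= C -> 0 < d -> 0 < X ->
  `|n| <= C * X ^+ 2 -> d * X <= `|d1| -> d * X <= `|d2| ->
  [/\ d1 != 0, d2 != 0 & `|n / (d1 * d2)| <= C / d ^+ 2].
Proof.
move=> C0 d0 X0 hn h1 h2; have dX : 0 < d * X by rewrite mulr_gt0.
have p1 : 0 < `|d1| by apply: lt_le_trans h1.
have p2 : 0 < `|d2| by apply: lt_le_trans h2.
split; rewrite -?normr_gt0 //.
rewrite normrM normfV ler_pdivrMr normrM ?mulr_gt0 //.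
apply: (le_trans hn).
have -> : C * X ^+ 2 = C / d ^+ 2 * ((d * X) * (d * X)).
  by field; rewrite gt_eqF.
by rewrite ler_wpM2l ?divr_ge0 ?exprn_ge0 ?ler_pM // ltW.
Qed.

End Bound.

(** * The Cauchy identity *)

Section Assembly.
Variables (R : realType) (N M : nat).
Local Notation K := R[i].
Variables (q : K) (x : 'I_N -> K) (y : 'I_M -> K) (z : nat -> K) (eps : R).
Hypotheses (hpoles : away_from_poles q x y z)
    (heps : eps < 1) (eps_ge0 : 0 <= eps)
    (h1 : forall i j k,
       `| (1 - q ^+ 3 * y j * z k) / (1 - q * y j * z k)
          * ((x i - z k) / (x i - q ^+ 2 * z k)) | < eps%:C)
    (h2 : forall i j k,
       `| ((1 - q ^+ 2 * y j * z k) * (1 - q ^+ 3 * y j * z k))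
            / ((1 - y j * z k) * (1 - q * y j * z k))
          * (((x i - z k) * (x i - q * z k))
            / ((x i - q ^+ 2 * z k) * (x i - q ^+ 3 * z k))) | < eps%:C)
    (hmix : mixed_ratio_bounds eps q x y z).

Let xs : seq K := [seq x i | i <- enum 'I_N].
(* The order of the rows of G is reversed by the reflection. *)
Let ys : seq K := [seq y j | j <- rev (enum 'I_M)].

Lemma size_xs : size xs = N. Proof. by rewrite size_map size_enum_ord. Qed.
Lemma size_ys : size ys = M. Proof. by rewrite size_map size_rev size_enum_ord. Qed.

(** The weights are homogeneous, so that their numerators and denominators
compare with the same power of |x| + |z|, respectively 1 + |y z|. *)
Lemma uniform_weight_bound : exists2 B : K, 0 <= B & forall k,
  (forall i, [/\ x i - q ^+ 2 * z k != 0, x i - q ^+ 3 * z k != 0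
     & forall a b c d : state, `|ik_weight q (x i) (z k) a b c d| <= B]) /\
  (forall j, [/\ 1 - y j * z k != 0, 1 - q * y j * z k != 0
     & forall a b c d : state, `|crossed q (y j) (z k) a b c d| <= B]).
Proof.
have [q0 q1 z0 np [d d0 [Hx Hy]]] := hpoles.
have [C C0 HC] := ik_num_bound q.
have dC : 0 < d%:C by rewrite ltcR.
exists (C / d%:C ^+ 2); first by rewrite divr_ge0 ?exprn_ge0 // ltW.
move=> k; split => [i|j].
  have X0 : 0 < `|x i| + `|z k| by rewrite ltr_wpDl ?normr_gt0.
  have [e1 e2] := Hx i k.
  have H := ratio_bound C0 dC X0 (HC _ _ _ _ _ _) e1 e2.
  have [n1 n2 _] := H st0 st0 st0 st0; split => // a b c e.
  by rewrite ik_weight_num //; have [] := H a b c e.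
have X0 : 0 < 1 + `|y j * z k| by rewrite ltr_pwDl.
have [e1 e2] := Hy j k.
have HC' (a b c e : state) : `|ik_num q 1 (y j * z k) a b c e| <= C * (1 + `|y j * z k|) ^+ 2.
  by have := HC 1 (y j * z k) a b c e; rewrite normr1.
have H a b c e := ratio_bound C0 dC X0 (HC' a b c e) e1 e2.
have [n1 n2 _] := H st0 st0 st0 st0; split => // a b c e.
by rewrite /crossed mulrA; have [] := H a b c e.
Qed.

Lemma crossed_0101 (u v : K) : 1 - u * v != 0 ->
  crossed q u v 0%N 1%N 0%N 1%N = (1 - q ^+ 3 * u * v) / (1 - q * u * v).
Proof. by move=> n1; rewrite /crossed /= !mulrA -mulf_div divff // mul1r. Qed.

Lemma crossed_0000 (u v : K) :
  crossed q u v 0%N 0%N 0%N 0%N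
  = ((1 - q ^+ 2 * u * v) * (1 - q ^+ 3 * u * v)) / ((1 - u * v) * (1 - q * u * v)).
Proof. by rewrite /crossed /= !mulrA. Qed.

Lemma pairwise_neq (T : eqType) (r : rel T) (s : seq T) : uniq s ->
  (forall u v, u != v -> r u v) -> pairwise r s.
Proof. by rewrite uniq_pairwise => us H; apply: sub_pairwise us => u v; apply: H. Qed.

Lemma params_admissible : exists2 B : K, 0 <= B & admissible q B eps%:C xs ys z.
Proof.
have [B B0 H] := uniform_weight_bound; exists B => //; have [Hm1 Hm2] := hmix.
split => k.
- by move=> _ /mapP[i _ ->]; have [/(_ i)[]] := H k.
- by move=> _ /mapP[j _ ->]; have [_ /(_ j)[]] := H k.
- rewrite /cauchy_rows map_cat -!map_comp; have [Hx Hy] := H k; apply/every_cat; split.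
    apply: every_in => i _ a b c d /=; rewrite /abs_weight normr_ge0 /=.
    by have [_ _] := Hx i; apply.
  apply: every_in => j _ a b c d /=; rewrite /abs_weight normr_ge0 /=.
  by have [_ _] := Hy j; apply.
- have [_ Hy] := H k; split.
  + rewrite allrel_mapl allrel_mapr; apply/allrelP => i j _ _ /=.
    have [n1 _ _] := Hy j; rewrite crossed_0101 // -normrM mulrC; exact/ltW/h1.
  + rewrite allrel_mapl allrel_mapr; apply/allrelP => i j _ _ /=.
    rewrite crossed_0000 // -normrM mulrC; exact/ltW/h2.
  + apply/allP => _ /mapP[i _ ->]; rewrite pairwise_map.
    apply: pairwise_neq; first by rewrite rev_uniq enum_uniq.
    move=> j j' ne /=; have [n1 _ _] := Hy j; have [n1' _ _] := Hy j'.
    rewrite !crossed_0101 // -!normrM mulrC; exact/ltW/Hm1.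
  + apply/allP => _ /mapP[j _ ->]; rewrite pairwise_map.
    apply: pairwise_neq; first by rewrite enum_uniq.
    move=> i i' ne /=.
    rewrite crossed_0000 // -!normrM mulrA; exact/ltW/Hm2.
Qed.

(** The lattice of F below the lattice of crossed lines, joined along [S]. *)
Definition glued (L : nat) (S : nat -> state) : K :=
  grid N (fun k => [seq ik_weight q u (z k) | u <- xs]) (fun=> st0) S (iota 0 L)
    (nseq N st2) (nseq N st0)
  * grid M (fun k => [seq crossed q u (z k) | u <- ys]) S (twos_top N) (iota 0 L)
    (nseq M st2) (nseq M st2).

Lemma summand_glued (S : string2) L : size2 S = (2 * N)%N ->
  (supp_bound S <= L)%N -> (N <= L)%N ->
  cS q S * F q x z S * G q N y (fun k => q ^- 3 * (z k)^-1) S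
  = q ^+ (N * (2 * N + 1)) * glued L S.
Proof.
move=> sS leS leN; have [q0 q1 z0 _ _] := hpoles; have [B _ H] := uniform_weight_bound.
rewrite mulrAC (@cS_G _ _ _ _ y z S L) //; last first.
  by move=> j k; have [_ /(_ j)[]] := H k.
rewrite (F_grid _ _ _ leS) /glued mulrAC -!mulrA; congr (_ * (_ * _)).
  by apply: eq_grid => k _; split => //; rewrite /xs -[RHS]map_comp.
by apply: eq_grid => k _; split => //; rewrite /ys -[RHS]map_comp.
Qed.

Lemma sum_glued L :
  \sum_(t : L.-tuple state) glued L (nth st0 t) = cauchy_grid q xs ys z (ground N M) L.
Proof.
rewrite /cauchy_grid size_xs size_ys nseqD -grid_stack ?size_nseq //; last first.
  by move=> k; rewrite size_map size_xs.
by apply: eq_bigr => t _; congr (_ * _); apply: eq_grid => k _; rewrite subn0.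
Qed.

(** By conservation only the 2-strings of size 2N contribute. *)
Lemma glued_size L (t : L.-tuple state) :
  glued L (nth st0 t) != 0 -> size2 (string_of t) = (2 * N)%N.
Proof.
case/mul_neq0 => nz _.
have cons k : every (@conserving K) [seq ik_weight q u (z k) | u <- xs].
  by apply: every_map => u; apply: ik_weight_conserving.
have := grid_conserve cons nz.
rewrite !flow_nseq st2E st0E mul0n addn0 big1 ?add0n; last by move=> k _.
move=> ->; rewrite /size2 (@big_finsupp _ _ _ (string_of t) L) //.
- by apply: eq_bigr => k _; rewrite string_ofE.
- by rewrite (leq_trans (supp_string_of t)) ?size_tuple.
- by move=> k kS; rewrite fsfun_dflt.
Qed.

Lemma partial_sum_glued n :
  \sum_(S <- strings_below (2 * N) (N + n))
     cS q (val S) * F q x z (val S) * G q N y (fun k => q ^- 3 * (z k)^-1) (val S)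
  = q ^+ (N * (2 * N + 1)) * cauchy_grid q xs ys z (ground N M) (N + n).
Proof.
rewrite (sum_strings_below _ _ (fun S => cS q S * F q x z S
  * G q N y (fun k => q ^- 3 * (z k)^-1) S)).
rewrite -sum_glued mulr_sumr big_mkcond; apply: eq_bigr => t _.
have tk k : string_of t k = nth st0 t k by apply: string_ofE.
case: eqP => [ts|ts].
  rewrite (@summand_glued _ (N + n)%N ts) ?leq_addr
    ?(leq_trans (supp_string_of t)) ?size_tuple //.
  by congr (_ * (_ * _)); apply: eq_grid => k _; rewrite tk.
have [->|/glued_size //] := eqVneq (glued (N + n) (nth st0 t)) 0.
by rewrite mulr0.
Qed.

Lemma partial_sum_norms : exists C : K, forall n,
  \sum_(S <- strings_below (2 * N) (N + n))
     `|cS q (val S) * F q x z (val S) * G q N y (fun k => q ^- 3 * (z k)^-1) (val S)|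
  <= C.
Proof.
have [B B0 H] := params_admissible.
pose eps' : R := (eps + 1) / 2.
have [lt1 lt2] : eps < eps' /\ eps' < 1 by rewrite /eps' !(midf_lt heps).
have le1 := ltW lt2.
have [||| D D0 HD] := abs_bound B0 _ _ _ H (eps' := eps'%:C).
- by rewrite lecR.
- by rewrite ltcR.
- by rewrite lecR.
exists (`|q ^+ (N * (2 * N + 1))| * D) => n.
rewrite (sum_strings_below _ _ (fun S => `|cS q S * F q x z S
  * G q N y (fun k => q ^- 3 * (z k)^-1) S|)) big_mkcond /=.
have := HD n (ground N M).
rewrite size_xs size_ys size_ground flow_ground eqxx mulr1 => /(_ erefl erefl) HD'.
apply: le_trans (ler_wpM2l (normr_ge0 _) HD').
rewrite /cauchy_rows -[X in grid _ X](_ : (fun k =>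
   map (@abs_weight K) [seq ik_weight q u (z k) | u <- xs]
   ++ map (@abs_weight K) [seq crossed q u (z k) | u <- ys]) = _); last first.
  by apply: boolp.funext => k; rewrite map_cat.
rewrite nseqD -grid_stack ?size_nseq //; last first.
  by move=> k; rewrite size_map size_map size_xs.
rewrite mulr_sumr; apply: ler_sum => t _.
have tk k : string_of t k = nth st0 t k by apply: string_ofE.
case: eqP => [ts|_]; last first.
  apply: mulr_ge0 => //; apply: mulr_ge0; apply: le_trans (norm_grid _ _ _ _ _ _ _) => //.
rewrite (@summand_glued _ (N + n)%N ts) ?leq_addr
  ?(leq_trans (supp_string_of t)) ?size_tuple //.
rewrite normrM ler_wpM2l // /glued normrM.
have E1 : grid N (fun k => [seq ik_weight q u (z k) | u <- xs]) (fun=> st0) (string_of t)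
   (iota 0 (N + n)) (nseq N st2) (nseq N st0)
  = grid N (fun k => [seq ik_weight q u (z k) | u <- xs]) (fun=> st0) (fun k => nth st0 t (k - 0))
   (iota 0 (N + n)) (nseq N st2) (nseq N st0).
  by apply: eq_grid => k _; rewrite subn0 tk.
have E2 : grid M (fun k => [seq crossed q u (z k) | u <- ys]) (string_of t) (twos_top N)
   (iota 0 (N + n)) (nseq M st2) (nseq M st2)
  = grid M (fun k => [seq crossed q u (z k) | u <- ys]) (fun k => nth st0 t (k - 0)) (twos_top N)
   (iota 0 (N + n)) (nseq M st2) (nseq M st2).
  by apply: eq_grid => k _; rewrite subn0 tk.
by rewrite E1 E2; apply: ler_pM => //; apply: norm_grid.
Qed.

Lemma partial_sum_limit (e : R) : 0 < e -> exists n0, forall n, (n0 <= n)%N ->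
  `|q ^+ (N * (2 * N + 1)) * cauchy_grid q xs ys z (ground N M) (N + n)
    - q ^+ (N * (2 * N + 1)) * F q x z (twos N)
      * \prod_(i < N) \prod_(j < M)
         (((1 - q ^+ 2 * x i * y j) * (1 - q ^+ 3 * x i * y j))
          / ((1 - x i * y j) * (1 - q * x i * y j)))| <= e%:C.
Proof.
move=> e0; have [B B0 H] := params_admissible.
pose eps' : R := (eps + 1) / 2.
have [lt1 lt2] : eps < eps' /\ eps' < 1 by rewrite /eps' !(midf_lt heps).
have eps'0 : 0 <= eps' := le_trans eps_ge0 (ltW lt1).
have [_ _ _ np _] := hpoles.
have npxy : {in xs & ys, forall u v, 1 - u * v != 0 /\ 1 - q * (u * v) != 0}.
  by move=> _ _ /mapP[i _ ->] /mapP[j _ ->]; rewrite mulrA; apply/andP.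
have [|||D D0 HD] := cauchy_grid_limit B0 _ _ _ H npxy (eps' := eps'%:C).
- by rewrite lecR.
- by rewrite ltcR.
- by rewrite lecR ltW.
have FE : F q x z (twos N) = cauchy_grid q xs [::] z (ground N 0) N.
  rewrite (@F_grid _ _ _ _ _ _ N); last first.
    by apply: supp_boundP => k h; rewrite twosE /twos_top ltnNge h.
  rewrite /cauchy_grid /= addn0 size_xs /ground cats0; apply: eq_grid => k _.
  by rewrite twosE; split => //; rewrite /cauchy_rows cats0 /xs -[RHS]map_comp.
have PE : \prod_(i < N) \prod_(j < M)
         (((1 - q ^+ 2 * x i * y j) * (1 - q ^+ 3 * x i * y j))
          / ((1 - x i * y j) * (1 - q * x i * y j)))
   = \prod_(v <- ys) \prod_(u <- xs) cauchy_factor q u v.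
  rewrite exchange_big /= /ys big_map [RHS](perm_big (enum 'I_M)) ?perm_rev // big_enum /=.
  apply: eq_bigr => j _; rewrite /xs big_map big_enum /=.
  by apply: eq_bigr => i _; rewrite /cauchy_factor !mulrA.
rewrite FE PE; have := HD; rewrite size_xs size_ys => HD'.
set c := q ^+ (N * _).
have [D' D'0 DE] : exists2 D' : R, 0 <= D' & `|c| * D = D'%:C.
  have /complex_realP[r rE] : `|c| * D \is Num.real by rewrite realE mulr_ge0.
  by exists r => //; rewrite -lecR -rE mulr_ge0.
have [n0 Hn0] := geometric_small D' eps'0 lt2 e0.
exists n0 => n len; rewrite -mulrA -mulrBr normrM.
apply: le_trans (ler_wpM2l (normr_ge0 _) (HD' n)) _.
by rewrite mulrA DE -rmorphXn -rmorphM lecR Hn0.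
Qed.

End Assembly.

Theorem theorem1p6p1 (R : realType) (N M : nat) (hN : (1 <= N)%N)
    (hM : (1 <= M)%N) (q : R[i]) (x : 'I_N -> R[i]) (y : 'I_M -> R[i])
    (z : nat -> R[i]) (eps : R)
    (hpoles : away_from_poles q x y z)
    (heps : eps < 1)
    (h1 : forall i j k,
       `| (1 - q ^+ 3 * y j * z k) / (1 - q * y j * z k)
          * ((x i - z k) / (x i - q ^+ 2 * z k)) | < eps%:C)
    (h2 : forall i j k,
       `| ((1 - q ^+ 2 * y j * z k) * (1 - q ^+ 3 * y j * z k))
            / ((1 - y j * z k) * (1 - q * y j * z k))
          * (((x i - z k) * (x i - q * z k))
            / ((x i - q ^+ 2 * z k) * (x i - q ^+ 3 * z k))) | < eps%:C)
    (hmix : mixed_ratio_bounds eps q x y z) :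
  has_sum
    (fun S : strings_of_size (2 * N) =>
       cS q (val S) * F q x z (val S)
       * G q N y (fun k => q ^- 3 * (z k)^-1) (val S))
    (q ^+ (N * (2 * N + 1)) * F q x z (twos N)
     * \prod_(i < N) \prod_(j < M)
         (((1 - q ^+ 2 * x i * y j) * (1 - q ^+ 3 * x i * y j))
          / ((1 - x i * y j) * (1 - q * x i * y j)))).
Proof.
(* As N and M are positive, h1 is not vacuous. *)
have eps0 : 0 <= eps.
  have := h1 (Ordinal hN) (Ordinal hM) 0%N.
  by move/(le_lt_trans (normr_ge0 _)); rewrite ltcR => /ltW.
have [C HC] := partial_sum_norms hpoles heps eps0 h1 h2 hmix.
apply: (has_sum_exhaust (A := fun n => strings_below (2 * N) (N + n)) (C := C)).
- move=> n m le; apply/fsubsetP => S; rewrite !mem_strings_below => h.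
  by apply: leq_trans h _; rewrite leq_add2l.
- by move=> S; exists (supp_bound (val S)); rewrite mem_strings_below leq_addl.
- exact: HC.
move=> e e0; have [n0 Hn0] := partial_sum_limit hpoles heps eps0 h1 h2 hmix e0.
by exists n0 => n len; rewrite (partial_sum_glued hpoles) // Hn0.
Qed.
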